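(* For every $w\in W$, the following identities hold in $Q_W^*$: (1) $\displaystyle \mathrm{St}^+_w=\sum_{v\le w}v(a^+_{w^{-1},v^{-1}})\,x_{-w_0}\,f_v.$ (2) $\displaystyle q_{w_0w}\mathrm{St}^-_w=\hat x_{w_0}(\tau^-_w)^*=\sum_{v\ge w}\hat x_{w_0}b^-_{v,w}f_v=\sum_{v\ge w}\frac{\hat x_{w_0}x_{-v}}{\hat x_v}K^\tau_{w,v}f_v=\sum_{v\ge w}v(\hat x_{v^{-1}w_0})\,x_{-v}\,K^\tau_{w,v}f_v.$
   Context: $G$ is a complex reductive group with maximal torus $A$ contained in a Borel subgroup $B$, Weyl group $W$ (length $\ell$, Bruhat order $\le$, identity $e$, longest element $w_0$), $\Lambda$ the character group of $A$, $\Sigma^+$ the roots of $B$ ($\alpha>0$), $\Sigma^-=-\Sigma^+$, $\alpha_i$ the simple roots, $s_i$ the simple reflections. $R=\mathbb Z[q^{1/2},q^{-1/2}]$, $S=R[\Lambda]$ (basis $e^\lambda$), $Q=\mathrm{Frac}(S)$; $W$ acts on $Q$ by $w(e^\lambda)=e^{w\lambda}$, fixing $R$. Notation: $q_w=q^{\ell(w)}$, $x_\alpha=1-e^{-\alpha}$, $\hat x_\alpha=1-qe^{-\alpha}$, $\Sigma_w=w\Sigma^-\cap\Sigma^+$, $x_{-w}=\prod_{\beta\in\Sigma_w}x_{-\beta}$, $\hat x_w=\prod_{\beta\in\Sigma_w}\hat x_\beta$ (so $x_{-w_0}=\prod_{\alpha>0}(1-e^\alpha)$, $\hat x_{w_0}=\prod_{\alpha>0}(1-qe^{-\alpha})$).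 $Q_W=\bigoplus_{w\in W}Q\delta_w$ has product $(p\delta_w)(p'\delta_{w'})=p\,w(p')\delta_{ww'}$. For simple $\alpha_i$ put $$\tau^+_i=\frac{q-1}{1-e^{\alpha_i}}+\frac{q-e^{\alpha_i}}{1-e^{-\alpha_i}}\delta_{s_i},\qquad \tau^-_i=\frac{q-1}{1-e^{\alpha_i}}+\frac{1-qe^{-\alpha_i}}{1-e^{\alpha_i}}\delta_{s_i}.$$ They satisfy the braid relations and $(\tau^\pm_i)^2=(q-1)\tau^\pm_i+q$; $\tau^\pm_w$ is the product along a reduced word, and $\{\tau^\pm_w\}$ are $Q$-bases of $Q_W$. Write $\tau^\pm_w=\sum_{v\le w}a^\pm_{w,v}\delta_v$ and $\delta_w=\sum_{v\le w}b^\pm_{w,v}\tau^\pm_v$ with $a^\pm_{w,v},b^\pm_{w,v}\in Q$. $Q_W^*=\mathrm{Hom}_Q(Q_W,Q)=\mathrm{Hom}(W,Q)$ has the $Q$-basis $f_w$, $f_w(\delta_v)=\delta_{w,v}$; $(\tau^-_w)^*\in Q_W^*$ is the basis dual to $\tau^-_w$. $Q_W$ acts $Q$-linearly on $Q_W^*$ by $p\bullet f_v=v(p)f_v$ ($p\in Q$), $\delta_w\bullet f_v=f_{vw^{-1}}$. Define $\mathrm{St}^+_w=\tau^+_{w^{-1}}\bullet(x_{-w_0}f_e)$ and $\mathrm{St}^-_w=(\tau^-_{w_0w})^{-1}\bullet(x_{-w_0}f_{w_0})$. Let $Q^y$ be a second copy of $Q$ and $\hat Q_W=Q^y\otimes_RQ_W$,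 so $Q^y$ commutes with $Q_W$. For a reduced word $w=s_{i_1}\cdots s_{i_l}$ put $\beta_j=s_{i_1}\cdots s_{i_{j-1}}(\alpha_{i_j})$ and $\mathcal R^{\tau^\pm}_w=\prod_{j=1}^l\big(\tau^\pm_{i_j}-\frac{q-1}{1-e^{\beta_j}}\big)\in\hat Q_W$ (ordered product, fractions in $Q^y$). Write $\mathcal R^{\tau^\pm}_w=\sum_{v\le w}K^\tau_{v,w}\tau^\pm_v$, $K^\tau_{v,w}\in Q^y$; these are the same for $+$ and $-$ and independent of the reduced word, and are regarded as elements of $Q$ via $Q^y=Q$. *)

(* Defs.v *)
From HB Require Import structures.
From Stdlib Require Import ClassicalEpsilon.
From mathcomp Require Import all_boot all_order all_fingroup all_algebra.
From mathcomp Require Import mpoly zify.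

Set Implicit Arguments.
Unset Strict Implicit.
Unset Printing Implicit Defensive.

Import Order.TTheory GRing.Theory Num.Theory.
Local Open Scope ring_scope.

(* The matrix of s_a : x |-> x - <a^v, x> a acting on column vectors. *)
Definition reflmx n (a : 'cV[int]_n) (av : 'rV[int]_n) : 'M[int]_n :=
  1%:M - a *m av.

(* A complex reductive group with A inside B enters only through its based root
   datum: the character lattice of A is 'cV[int]_rk, the cocharacter lattice is
   'rV[int]_rk, and the pairing of a cocharacter with a character is the matrix
   product. By the classification theorem these records are exactly the root
   data of triples (G, B, A), G being determined up to isomorphism. *)
Record root_datum := RootDatum {
  rk : nat;
  posroots : seq 'cV[int]_rk;
  coroot : 'cV[int]_rk -> 'rV[int]_rk;
  nsimple : nat;
  simple : 'I_nsimple -> 'cV[int]_rk;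
  roots : seq 'cV[int]_rk := posroots ++ [seq - a | a <- posroots];
  roots_uniq : uniq roots;
  coroot_pair : forall a, a \in roots -> coroot a *m a = 2%:M;
  coroot_inj : {in roots &, injective coroot};
  reflmx_root : forall a b, a \in roots -> b \in roots ->
    reflmx a (coroot a) *m b \in roots;
  reflmx_coroot : forall a b, a \in roots -> b \in roots ->
    exists2 c, c \in roots & coroot c = coroot b *m reflmx a (coroot a);
  roots_reduced : forall (a b : 'cV[int]_rk) (m n : int),
    a \in roots -> b \in roots -> m != 0 -> m *: a = n *: b ->
    b = a \/ b = - a;
  simple_pos : forall i, simple i \in posroots;
  simple_free : forall c : 'I_nsimple -> int,
    \sum_i c i *: simple i = 0 -> forall i, c i = 0;
  posroots_simple : forall a, a \in posroots ->
    exists c : 'I_nsimple -> nat, a = \sum_i simple i *+ c i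
}.

(* The Weyl group N_G(A)/A: a finite group acting faithfully on the character
   lattice and generated by the simple reflections. *)
Record weyl_group (D : root_datum) := WeylGroup {
  weyl_sort :> finGroupType;
  wmx : weyl_sort -> 'M[int]_(rk D);
  srefl : 'I_(nsimple D) -> weyl_sort;
  wmx1 : wmx 1%g = 1%:M;
  wmxM : forall v w, wmx (v * w)%g = wmx v *m wmx w;
  wmx_inj : injective wmx;
  wmx_srefl : forall i,
    wmx (srefl i) = reflmx (simple i) (coroot (simple i));
  weyl_gen : <<[set srefl i | i : 'I_(nsimple D)]>>%g = [set: weyl_sort]
}.

(* R[Z^m] is a localization of Z[q^{1/2}, e^{eps_1}, ..., e^{eps_m}], so both
   have the same fraction field. Variable 0 is q^{1/2}. Lemmas
   laurent_free and laurent_frac identify it with Frac(R[Z^m]). *)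
Definition fracR m := {fraction {mpoly int[m.+1]}}.

Definition qh {m} : fracR m := FracField.tofrac 'X_ord0.
Definition qp {m} : fracR m := qh ^+ 2.
Definition ex {m} (l : 'cV[int]_m) : fracR m :=
  \prod_i (FracField.tofrac 'X_(lift ord0 i)) ^ (l i 0).

Definition fracR_ev m k (M : 'M[int]_(k, m)) : {mpoly int[m.+1]} -> fracR k :=
  mmap intr (fun i : 'I_m.+1 =>
    if unlift ord0 i is Some j then ex (col j M) else qh).

(* For M injective, the field embedding fixing q^{1/2} and sending ex l to
   ex (M *m l). *)
Definition fracR_map m k (M : 'M[int]_(k, m)) (f : fracR m) : fracR k :=
  let x : {ratio {mpoly int[m.+1]}} := generic_quotient.repr f in
  fracR_ev M (\n_x) / fracR_ev M (\d_x).

Lemma absz_le_addr0 (a : int) (n : nat) : (`|a| <= n)%N -> 0 <= a + n%:Z.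
Proof. by move=> le_an; rewrite -[a]opprK addrC subr_ge0; lia. Qed.

Section FracR.
Variable m : nat.
Implicit Types (l : 'cV[int]_m).

Lemma fracR_var_neq0 (i : 'I_m.+1) :
  FracField.tofrac 'X_i != 0 :> fracR m.
Proof.
rewrite tofrac_eq0; apply/eqP => /(congr1 (mcoeff U_(i)%MM)) /eqP.
by rewrite mcoeffX eqxx mcoeff0 oner_eq0.
Qed.

Lemma qh_neq0 : qh != 0 :> fracR m.
Proof. exact: fracR_var_neq0. Qed.

Lemma ex_neq0 l : ex l != 0.
Proof.
apply/prodf_neq0 => i _; exact/expfz_neq0/fracR_var_neq0.
Qed.

Lemma ex0 : ex (0 : 'cV[int]_m) = 1.
Proof. by rewrite /ex big1 // => i _; rewrite mxE expr0z. Qed.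

Lemma exD l1 l2 : ex (l1 + l2) = ex l1 * ex l2.
Proof.
rewrite /ex -big_split /=; apply: eq_bigr => i _; rewrite mxE expfzDr //.
exact: fracR_var_neq0.
Qed.

Lemma exN l : ex (- l) = (ex l)^-1.
Proof.
by apply: (mulfI (ex_neq0 l)); rewrite -exD subrr ex0 mulfV ?ex_neq0.
Qed.

Lemma laurent_free (I : eqType) (s : seq I) (g : I -> int * 'cV[int]_m)
    (c : I -> int) :
    uniq s -> {in s &, injective g} ->
    \sum_(p <- s) (c p)%:~R * (qh ^ (g p).1 * ex (g p).2) = 0 :> fracR m ->
  forall p, p \in s -> c p = 0.
Proof.
move=> us gI sum0.
pose B (p : I) : nat := (`|(g p).1| + \sum_i `|(g p).2 i 0%R|)%N.
pose N := (\sum_(p <- s) B p)%N.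
have leN p : p \in s -> (B p <= N)%N.
  by move=> ps; rewrite /N (big_rem p) //= leq_addr.
have ge1 p : p \in s -> 0 <= (g p).1 + N%:Z.
  move=> /leN; rewrite /B => H.
  have {}H : (`|(g p).1| <= N)%N by apply: leq_trans H; rewrite leq_addr.
  exact: absz_le_addr0.
have ge2 p i : p \in s -> 0 <= (g p).2 i 0 + N%:Z.
  move=> /leN; rewrite /B => H.
  have {}H : (`|(g p).2 i 0%R| <= N)%N.
    by apply: leq_trans H; rewrite (bigD1 i) //= addnCA leq_addr.
  exact: absz_le_addr0.
pose mn (p : I) : 'X_{1..m.+1} :=
  [multinom (if unlift ord0 i is Some j then absz ((g p).2 j 0 + N%:Z)%R
             else absz ((g p).1 + N%:Z)%R) | i < m.+1].
have mnI : {in s &, injective mn}.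
  move=> p p' ps ps' /mnmP E.
  have E1 : (g p).1 = (g p').1.
    move: (E ord0); rewrite !mnmE unlift_none => H; apply: (@addIr _ N%:Z).
    by rewrite -(gez0_abs (ge1 _ ps)) -(gez0_abs (ge1 _ ps')) H.
  have E2 : (g p).2 = (g p').2.
    apply/colP => i; move: (E (lift ord0 i)); rewrite !mnmE liftK => H.
    apply: (@addIr _ N%:Z).
    by rewrite -(gez0_abs (ge2 _ i ps)) -(gez0_abs (ge2 _ i ps')) H.
  by apply: gI => //; rewrite [LHS]surjective_pairing E1 E2 -surjective_pairing.
pose P : {mpoly int[m.+1]} := \sum_(p <- s) c p *: 'X_[mn p].
have P0 : P = 0.
  apply/eqP; rewrite -(tofrac_eq0 P); apply/eqP.
  rewrite -[RHS](mulr0 (qh ^+ N * ex (const_mx N%:Z))) -sum0 big_distrr /=.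
  rewrite /P rmorph_sum /=; apply: eq_big_seq => p ps.
  rewrite -mul_mpolyC rmorphM /= mulrCA; congr (_ * _).
    by rewrite -[c p in LHS]intz !rmorph_int.
  rewrite mulrACA -exD mpolyXE_id rmorph_prod big_ord_recl /=; congr (_ * _).
    rewrite rmorphXn /= mnmE unlift_none.
    have -> : qh ^+ N * qh ^ (g p).1 = qh ^ ((g p).1 + N%:Z) :> fracR m.
      by rewrite addrC expfzDr ?qh_neq0.
    by rewrite -{2}(gez0_abs (ge1 _ ps)).
  rewrite /ex; apply: eq_bigr => i _; rewrite rmorphXn /= mnmE liftK !mxE.
  by rewrite [N%:Z + _]addrC -{2}(gez0_abs (ge2 _ i ps)).
move=> p ps; move: (congr1 (mcoeff (mn p)) P0).
rewrite mcoeff0 raddf_sum /= (bigD1_seq p) //= big_seq_cond big1 ?addr0.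
  by rewrite mcoeffZ mcoeffX eqxx mulr1.
move=> p' /andP[p's ne]; rewrite mcoeffZ mcoeffX.
case: eqP => [/mnI H|_]; last by rewrite mulr0.
by move: ne; rewrite (H p's ps) eqxx.
Qed.

Lemma fracR_numden (R : idomainType) (f : {fraction R}) :
  let x : {ratio R} := generic_quotient.repr f in
  f = FracField.tofrac (\n_x) / FracField.tofrac (\d_x).
Proof.
move=> x; rewrite -[LHS]generic_quotient.reprK -/x /FracField.tofrac.
unlock FracField.tofrac; rewrite -[X in _ = _ * X]FracField.pi_inv.
rewrite -[RHS]FracField.pi_mul.
set y := FracField.mulf _ _; suff -> : y = x by [].
rewrite /y /FracField.invf /FracField.mulf !numden_Ratio ?oner_neq0 //.
  by rewrite mul1r mulr1 FracField.Ratio_numden.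
all: by apply: denom_ratioP.
Qed.

Lemma ex_sum I (r : seq I) (F : I -> 'cV[int]_m) :
  ex (\sum_(i <- r) F i) = \prod_(i <- r) ex (F i).
Proof. exact: (big_morph ex exD ex0). Qed.

Lemma exMn l n : ex (l *+ n) = ex l ^+ n.
Proof. by elim: n => [|n IH]; rewrite ?ex0 // mulrS exD IH exprS. Qed.

Lemma exZ (a : int) l : ex (a *: l) = ex l ^ a.
Proof.
have exZn n : ex (n%:Z *: l) = ex l ^+ n by rewrite -natz scaler_nat exMn.
by case: a => n; rewrite ?exZn // {1}NegzE scaleNr exN exZn.
Qed.

End FracR.

Definition mnm_vec m (u : 'X_{1..m.+1}) : int * 'cV[int]_m :=
  ((u ord0)%:Z, \col_i (u (lift ord0 i))%:Z).

Lemma mnm_vec_inj m : injective (@mnm_vec m).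
Proof.
move=> u v [E0 /colP E]; apply/mnmP => i; case: (unliftP ord0 i) => [j ->|-> //].
by move: (E j); rewrite !mxE => -[].
Qed.

Lemma col_sum m k (M : 'M[int]_(k, m)) (l : 'cV[int]_m) :
  M *m l = \sum_j l j 0 *: col j M.
Proof.
apply/colP => i; rewrite !mxE summxE; apply: eq_bigr => j _.
by rewrite !mxE mulrC.
Qed.

Section FracRMap.
Variables (m k : nat) (M : 'M[int]_(k, m)).
Hypothesis Minj : injective (mulmx M : 'cV[int]_m -> 'cV[int]_k).

Lemma fracR_evX u :
  mmap1 (fun i : 'I_m.+1 => if unlift ord0 i is Some j then ex (col j M) else qh)
    u = qh ^ (mnm_vec u).1 * ex (M *m (mnm_vec u).2).
Proof.
rewrite /mmap1 big_ord_recl unlift_none /=; congr (_ * _).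
rewrite col_sum ex_sum; apply: eq_bigr => i _.
by rewrite liftK mxE exZ.
Qed.

Lemma fracR_evE p : fracR_ev M p =
  \sum_(u <- msupp p)
    (p@_u)%:~R * (qh ^ (mnm_vec u).1 * ex (M *m (mnm_vec u).2)).
Proof. by apply: eq_bigr => u _; rewrite fracR_evX. Qed.

Lemma fracR_ev_eq0 p : (fracR_ev M p == 0) = (p == 0).
Proof.
apply/eqP/eqP => [|->]; last exact: mmap0.
rewrite fracR_evE => H; apply/mpolyP => u; rewrite mcoeff0.
apply/eqP/negPn/negP => nz.
pose g (u : 'X_{1..m.+1}) := ((mnm_vec u).1, M *m (mnm_vec u).2).
have gI : injective g.
  move=> a b gab; apply: mnm_vec_inj.
  have E1 : (mnm_vec a).1 = (mnm_vec b).1 := congr1 fst gab.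
  have E2 : (mnm_vec a).2 = (mnm_vec b).2 by apply/Minj/(congr1 snd gab).
  by rewrite [LHS]surjective_pairing E1 E2 -surjective_pairing.
have up : u \in msupp p by rewrite mcoeff_msupp.
move/eqP: nz; apply.
by apply: (laurent_free (msupp_uniq p) (in2W gI) H up).
Qed.

Lemma fracR_ev_zmod : zmod_morphism (fracR_ev M).
Proof. by move=> a b; rewrite /fracR_ev rmorphB. Qed.
Lemma fracR_ev_monoid : monoid_morphism (fracR_ev M).
Proof. by split=> [|a b]; rewrite /fracR_ev ?rmorph1 ?rmorphM. Qed.
HB.instance Definition _ := GRing.isZmodMorphism.Build
  {mpoly int[m.+1]} (fracR k) (fracR_ev M) fracR_ev_zmod.
HB.instance Definition _ := GRing.isMonoidMorphism.Build
  {mpoly int[m.+1]} (fracR k) (fracR_ev M) fracR_ev_monoid.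

Lemma fracR_map_frac a b : b != 0 ->
  fracR_map M (FracField.tofrac a / FracField.tofrac b) =
  fracR_ev M a / fracR_ev M b.
Proof.
move=> b0; rewrite /fracR_map; move: (fracR_numden (FracField.tofrac a / FracField.tofrac b)).
set x := generic_quotient.repr _ => /= E.
have d0 : \d_x != 0 by apply: denom_ratioP.
apply/eqP; rewrite eqr_div ?fracR_ev_eq0 // -!rmorphM /=.
move/eqP: E; rewrite eqr_div ?tofrac_eq0 // -!rmorphM tofrac_eq => /eqP <-.
by [].
Qed.

Lemma fracR_fracP (f : fracR m) : exists a b,
  b != 0 /\ f = FracField.tofrac a / FracField.tofrac b.
Proof.
move: (fracR_numden f) => /=; set x := generic_quotient.repr f => E.
by exists (\n_x), (\d_x); split=> //; apply: denom_ratioP.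
Qed.

Lemma fracR_map_zmod : zmod_morphism (fracR_map M).
Proof.
move=> f g; have [a [b [b0 ->]]] := fracR_fracP f.
have [c [d [d0 ->]]] := fracR_fracP g.
rewrite -mulNr addf_div ?tofrac_eq0 // -rmorphN -!rmorphM -rmorphD /=.
rewrite !fracR_map_frac ?mulf_neq0 // rmorphD !rmorphM rmorphN.
by rewrite -[in RHS]mulNr addf_div ?fracR_ev_eq0.
Qed.

Lemma fracR_map_tofrac a : fracR_map M (FracField.tofrac a) = fracR_ev M a.
Proof.
by rewrite -[FracField.tofrac a]divr1 -(rmorph1 (@FracField.tofrac _))
           fracR_map_frac ?oner_eq0 // rmorph1 divr1.
Qed.

Lemma fracR_map_monoid : monoid_morphism (fracR_map M).
Proof.
split; first by rewrite -(rmorph1 (@FracField.tofrac _)) fracR_map_tofrac rmorph1.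
move=> f g; have [a [b [b0 ->]]] := fracR_fracP f.
have [c [d [d0 ->]]] := fracR_fracP g.
rewrite mulf_div -!rmorphM /= !fracR_map_frac ?mulf_neq0 //.
by rewrite !rmorphM mulf_div.
Qed.

Lemma fracR_map_qh : fracR_map M qh = qh.
Proof. by rewrite fracR_map_tofrac /fracR_ev mmapX mmap1U unlift_none. Qed.

Definition fracR_rmorphism : {rmorphism fracR m -> fracR k} :=
  HB.pack (fracR_map M)
    (GRing.isZmodMorphism.Build _ _ (fracR_map M) fracR_map_zmod)
    (GRing.isMonoidMorphism.Build _ _ (fracR_map M) fracR_map_monoid).

Lemma fracR_map_ex l : fracR_map M (ex l) = ex (M *m l).
Proof.
rewrite -[LHS]/(fracR_rmorphism (ex l)) rmorph_prod col_sum ex_sum /=.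
apply: eq_bigr => i _; rewrite exZ.
have -> : ex (col i M) = fracR_rmorphism (FracField.tofrac 'X_(lift ord0 i)).
  by rewrite /= fracR_map_tofrac /fracR_ev mmapX mmap1U liftK.
rewrite -[LHS]/(fracR_rmorphism _).
by case: (l i 0) => n; rewrite ?rmorphXn // NegzE -!exprnN fmorphV rmorphXn.
Qed.

End FracRMap.

Lemma mulmx1_inj m : injective (mulmx (1%:M : 'M[int]_m) : 'cV_m -> 'cV_m).
Proof. by move=> a b; rewrite !mul1mx. Qed.

Lemma fracR_ev1 m p : fracR_ev 1%:M p = FracField.tofrac p :> fracR m.
Proof.
rewrite fracR_evE [in RHS](mpolyE p) rmorph_sum /=; apply: eq_bigr => u _.
rewrite mul1mx -mul_mpolyC rmorphM /=; congr (_ * _).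
  by rewrite -[p@_u in RHS]intz !rmorph_int.
rewrite mpolyXE_id rmorph_prod big_ord_recl /= rmorphXn; congr (_ * _).
by apply: eq_bigr => i _; rewrite rmorphXn mxE.
Qed.

Lemma fracR_map1 m (f : fracR m) : fracR_map 1%:M f = f.
Proof.
have [a [b [b0 ->]]] := fracR_fracP f.
by rewrite (fracR_map_frac (@mulmx1_inj m)) // !fracR_ev1.
Qed.

Lemma fracR_map_comp m k n (M : 'M[int]_(n, k)) (N : 'M[int]_(k, m))
    (f : fracR m) :
  injective (mulmx M : 'cV_k -> 'cV_n) -> injective (mulmx N : 'cV_m -> 'cV_k) ->
  fracR_map (M *m N) f = fracR_map M (fracR_map N f).
Proof.
move=> Mi Ni.
have MNi : injective (mulmx (M *m N) : 'cV_m -> 'cV_n).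
  by move=> a b; rewrite -!mulmxA => /Mi/Ni.
have evM p : fracR_ev (M *m N) p = fracR_map M (fracR_ev N p).
  rewrite !fracR_evE -[RHS]/(fracR_rmorphism Mi _) rmorph_sum /=.
  apply: eq_bigr => u _; have [_ MM] := fracR_map_monoid Mi.
  have Mz n : fracR_map M n%:~R = n%:~R := rmorph_int (fracR_rmorphism Mi) n.
  rewrite !MM Mz (fracR_map_ex Mi) mulmxA.
  have Mt n : fracR_map M (qh ^ Posz n) = fracR_map M qh ^+ n :=
    rmorphXn (fracR_rmorphism Mi) n qh.
  by rewrite Mt (fracR_map_qh Mi).
have [a [b [b0 ->]]] := fracR_fracP f.
rewrite !fracR_map_frac // !evM -[RHS]/(fracR_rmorphism Mi _).
by rewrite fmorph_div.
Qed.

Lemma laurent_frac m (f : fracR m) :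
  exists s1 s2 : seq (int * (int * 'cV[int]_m)),
    f = (\sum_(p <- s1) p.1%:~R * (qh ^ p.2.1 * ex p.2.2))
      / (\sum_(p <- s2) p.1%:~R * (qh ^ p.2.1 * ex p.2.2)).
Proof.
have [a [b [_ ->]]] := fracR_fracP f.
pose s (p : {mpoly int[m.+1]}) := [seq (p@_u, mnm_vec u) | u <- msupp p].
exists (s a), (s b); rewrite -!fracR_ev1 !fracR_evE !big_map.
by congr (_ / _); apply: eq_bigr => u _; rewrite mul1mx.
Qed.

Record field_action (W : finGroupType) (F : fieldType) := FieldAction {
  fact :> W -> F -> F;
  fact_zmod : forall w, zmod_morphism (fact w);
  fact_monoid : forall w, monoid_morphism (fact w);
  fact1 : forall x, fact 1%g x = x;
  factM : forall v w x, fact (v * w)%g x = fact v (fact w x)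
}.

HB.instance Definition _ W F (A : field_action W F) w :=
  GRing.isZmodMorphism.Build F F (fact A w) (fact_zmod A w).
HB.instance Definition _ W F (A : field_action W F) w :=
  GRing.isMonoidMorphism.Build F F (fact A w) (fact_monoid A w).

(* The left F-vector space with basis delta_w, z w being the coefficient of
   delta_w in z. *)
Definition twisted (W : finGroupType) (F : fieldType) (A : field_action W F) :=
  {ffun W -> F^o}.

HB.instance Definition _ W F (A : field_action W F) :=
  Vector.copy (twisted A) {ffun W -> F^o}.

Section Twisted.
Variables (W : finGroupType) (F : fieldType) (A : field_action W F).
Local Notation QW := (twisted A).
Implicit Types (x y z : QW) (v w : W) (p : F).

Definition tdelta w : QW := [ffun v => (v == w)%:R].

Definition tmul x y : QW :=
  \sum_v \sum_w (x v * A v (y w)) *: tdelta (v * w)%g.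

Lemma tdeltaE w v : tdelta w v = (v == w)%:R.
Proof. by rewrite ffunE. Qed.

Lemma twisted_sum_delta x : x = \sum_w x w *: tdelta w.
Proof.
apply/ffunP => u; rewrite sum_ffunE (bigD1 u) //= !ffunE eqxx.
rewrite big1 ?addr0 => [|v /negbTE nv]; first by rewrite [RHS]mulr1.
by rewrite !ffunE eq_sym nv [LHS]mulr0.
Qed.

Lemma tmulE x y u : tmul x y u = \sum_v x v * A v (y (v^-1 * u)%g).
Proof.
rewrite sum_ffunE; apply: eq_bigr => v _.
rewrite sum_ffunE (bigD1 (v^-1 * u)%g) //= big1 ?addr0 => [|w].
  by rewrite !ffunE mulKVg eqxx [LHS]mulr1.
move=> nw; rewrite !ffunE; have /negbTE -> : u != (v * w)%g; last exact: mulr0.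
by apply: contraNneq nw => ->; rewrite mulKg.
Qed.

Lemma tmulA : associative tmul.
Proof.
move=> x y z; apply/ffunP => u; rewrite !tmulE.
under eq_bigr => v _ do rewrite tmulE rmorph_sum big_distrr /=.
under [RHS]eq_bigr => v _ do rewrite tmulE big_distrl /=.
rewrite [RHS]exchange_big /=; apply: eq_bigr => v _.
rewrite [RHS](reindex_inj (mulgI v)) /=; apply: eq_bigr => w _.
by rewrite mulKg rmorphM mulrA factM invMg mulgA.
Qed.

Lemma tmul1x : left_id (tdelta 1) tmul.
Proof.
move=> x; apply/ffunP => u; rewrite tmulE (bigD1 1%g) //= big1 ?addr0.
  by rewrite ffunE eqxx mul1r fact1 invg1 mul1g.
by move=> v /negbTE nv; rewrite ffunE nv mul0r.
Qed.

Lemma tmulx1 : right_id (tdelta 1) tmul.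
Proof.
move=> x; apply/ffunP => u; rewrite tmulE (bigD1 u) //= big1 ?addr0.
  by rewrite ffunE mulVg eqxx rmorph1 mulr1.
move=> v nv; rewrite ffunE -(inj_eq (mulgI v)) mulKVg mulg1 eq_sym (negbTE nv).
by rewrite rmorph0 mulr0.
Qed.

Lemma tmulDl : left_distributive tmul +%R.
Proof.
move=> x y z; apply/ffunP => u; rewrite ffunE !tmulE -big_split /=.
by apply: eq_bigr => v _; rewrite ffunE mulrDl.
Qed.

Lemma tmulDr : right_distributive tmul +%R.
Proof.
move=> x y z; apply/ffunP => u; rewrite ffunE !tmulE -big_split /=.
by apply: eq_bigr => v _; rewrite ffunE rmorphD mulrDr.
Qed.

Lemma tone_neq0 : tdelta 1 != 0.
Proof.
apply/eqP => /ffunP /(_ 1%g) /eqP; rewrite !ffunE eqxx.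
exact/negP/oner_neq0.
Qed.

HB.instance Definition _ := GRing.Zmodule_isNzRing.Build (twisted A)
  tmulA tmul1x tmulx1 tmulDl tmulDr tone_neq0.

Lemma tscaleAl p x y : p *: (x * y) = (p *: x) * y.
Proof.
apply/ffunP => u; rewrite !ffunE !tmulE scaler_sumr.
by apply: eq_bigr => v _; rewrite !ffunE [LHS]mulrA.
Qed.

(* Right multiplications are linear over F, so an element is invertible exactly
   when its right multiplication has trivial kernel. *)
Definition trmul z : 'End(QW) := linfun (fun x : QW => x * z).

Lemma trmulE z x : trmul z x = x * z.
Proof.
have lin : linear (fun x : QW => x * z).
  by move=> p x1 x2; rewrite mulrDl tscaleAl.
pose f : {linear QW -> QW} :=
  HB.pack (fun x : QW => x * z) (GRing.isLinear.Build _ _ _ _ _ lin).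
by rewrite /trmul (lfunE f).
Qed.

Definition tunit : pred QW := fun z => lker (trmul z) == 0%VS.
Definition tinv z : QW := if tunit z then (trmul z)^-1%VF 1 else z.

Lemma tmulVx : {in tunit, left_inverse 1 tinv *%R}.
Proof.
move=> z uz; rewrite /tinv; have uz' : tunit z by [].
by rewrite uz' -trmulE lker0_lfunVK.
Qed.

Lemma tmulxV : {in tunit, right_inverse 1 tinv *%R}.
Proof.
move=> z uz; apply: (lker0P uz); rewrite !trmulE -mulrA.
by rewrite (tmulVx uz) mulr1 mul1r.
Qed.

Lemma tunitP z y : y * z = 1 /\ z * y = 1 -> tunit z.
Proof.
move=> [_ zy]; apply/lker0P => x1 x2; rewrite !trmulE => /(congr1 (fun x => x * y)).
by rewrite -!mulrA zy !mulr1.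
Qed.

Lemma tinv_out : {in [predC tunit], tinv =1 id}.
Proof. by move=> z /negbTE uz; rewrite /tinv ifF. Qed.

HB.instance Definition _ := GRing.NzRing_hasMulInverse.Build (twisted A)
  tmulVx tmulxV tunitP tinv_out.

End Twisted.

Section Weyl.
Variables (D : root_datum) (W : weyl_group D).
Implicit Types (u v w : W) (a : 'cV[int]_(rk D)).

Definition word_prod (s : seq 'I_(nsimple D)) : W :=
  (\prod_(i <- s) srefl W i)%g.

Lemma word_exists w : exists n, [exists s : n.-tuple _, word_prod s == w].
Proof.
have : w \in <<[set srefl W i | i : 'I_(nsimple D)]>>%g.
  by rewrite weyl_gen inE.
case/gen_prodgP => n [c cP ->].
have {}cP j : exists i, c j == srefl W i.
  by have /imsetP[i _ ->] := cP j; exists i.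
exists n; apply/existsP; exists [tuple xchoose (cP j) | j < n].
rewrite /word_prod big_tuple; apply/eqP/eq_bigr => j _.
by rewrite tnth_mktuple; apply/esym/eqP/(xchooseP (cP j)).
Qed.

Definition wlen w : nat := ex_minn (word_exists w).

Lemma redword_exists w : exists s : (wlen w).-tuple _, word_prod s == w.
Proof. by rewrite /wlen; case: ex_minnP => n /existsP. Qed.

Definition redword w : (wlen w).-tuple 'I_(nsimple D) :=
  xchoose (redword_exists w).

(* The Bruhat order is generated by u < u t for t a reflection (a conjugate of
   a simple reflection) with wlen u < wlen (u t). *)
Definition bruhat_step u v : bool :=
  (wlen u < wlen v)%N && [exists x, exists i, v == (u * srefl W i ^ x)%g].
Definition bruhat : rel W := connect bruhat_step.

Definition w0 : W := [arg max_(w > 1%g) wlen w].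

Definition negroots : seq 'cV[int]_(rk D) := [seq - a | a <- posroots D].

Definition Sigma_ w : seq 'cV[int]_(rk D) :=
  [seq b <- posroots D | b \in [seq wmx w *m a | a <- negroots]].

Lemma wmxV w : wmx w^-1 *m wmx w = 1%:M.
Proof. by rewrite -wmxM mulVg wmx1. Qed.

Lemma wmx_mul_inj w : injective (mulmx (wmx w) : 'cV_(rk D) -> 'cV_(rk D)).
Proof.
by move=> a b /(congr1 (mulmx (wmx w^-1))); rewrite !mulmxA wmxV !mul1mx.
Qed.

Definition Qfield := fracR (rk D).

Definition Wact w : Qfield -> Qfield := fracR_map (wmx w).

Lemma Wact1 p : Wact 1 p = p.
Proof. by rewrite /Wact wmx1 fracR_map1. Qed.

Lemma WactM v w p : Wact (v * w) p = Wact v (Wact w p).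
Proof.
by rewrite /Wact wmxM (fracR_map_comp _ (@wmx_mul_inj v) (@wmx_mul_inj w)).
Qed.

Definition Qaction : field_action W Qfield := FieldAction
  (fun w => fracR_map_zmod (@wmx_mul_inj w))
  (fun w => fracR_map_monoid (@wmx_mul_inj w)) Wact1 WactM.

Definition QW := twisted Qaction.

(* The fraction field of R[Lambda + Lambda]: the first summand carries Q and
   the second one Q^y, and W acts on the first one only. The ring Q^y (x)_R Q is
   a localization of R[Lambda + Lambda], hence a subring of Qxy; so the twisted
   algebra hQW contains Q^y (x)_R Q_W as a subring. *)
Definition Qxy := fracR (rk D + rk D).

Definition wmx2 w : 'M[int]_(rk D + rk D) := block_mx (wmx w) 0 0 1%:M.

Lemma wmx2M v w : wmx2 (v * w) = wmx2 v *m wmx2 w.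
Proof.
by rewrite /wmx2 mulmx_block !(mulmx0, mul0mx, mul1mx, addr0, add0r) wmxM.
Qed.

Lemma wmx21 : wmx2 1 = 1%:M.
Proof. by rewrite /wmx2 wmx1 -scalar_mx_block. Qed.

Lemma wmx2_mul_inj w :
  injective (mulmx (wmx2 w) : 'cV_(rk D + rk D) -> 'cV_(rk D + rk D)).
Proof.
move=> a b /(congr1 (mulmx (wmx2 w^-1))).
by rewrite !mulmxA -wmx2M mulVg wmx21 !mul1mx.
Qed.

Definition Wact2 w : Qxy -> Qxy := fracR_map (wmx2 w).

Lemma Wact21 p : Wact2 1 p = p.
Proof. by rewrite /Wact2 wmx21 fracR_map1. Qed.

Lemma Wact2M v w p : Wact2 (v * w) p = Wact2 v (Wact2 w p).
Proof.
by rewrite /Wact2 wmx2M (fracR_map_comp _ (@wmx2_mul_inj v) (@wmx2_mul_inj w)).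
Qed.

Definition Qxyaction : field_action W Qxy := FieldAction
  (fun w => fracR_map_zmod (@wmx2_mul_inj w))
  (fun w => fracR_map_monoid (@wmx2_mul_inj w)) Wact21 Wact2M.

Definition hQW := twisted Qxyaction.

Definition inx : Qfield -> Qxy := fracR_map (col_mx 1%:M 0).
Definition iny : Qfield -> Qxy := fracR_map (col_mx 0 1%:M).

Definition hat (z : QW) : hQW := [ffun w => inx (z w)].

Variant sgn := Plus | Minus.

Definition xr a : Qfield := 1 - ex (- a).
Definition xhat a : Qfield := 1 - qp * ex (- a).
Definition xminus w : Qfield := \prod_(b <- Sigma_ w) xr (- b).
Definition xhatw w : Qfield := \prod_(b <- Sigma_ w) xhat b.
Definition qw w : Qfield := qp ^+ wlen w.

Definition tau (e : sgn) (i : 'I_(nsimple D)) : QW :=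
  let a := simple i in
  ((qp - 1) / (1 - ex a)) *: (1 : QW) +
  (if e is Plus then (qp - ex a) / (1 - ex (- a))
   else (1 - qp * ex (- a)) / (1 - ex a)) *: tdelta Qaction (srefl W i).

Definition tauw (e : sgn) w : QW := \prod_(i <- redword w) tau e i.

Definition taubasis (e : sgn) : #|W|.-tuple QW :=
  [tuple tauw e (enum_val i) | i < #|W|].

Definition acoef (e : sgn) w v : Qfield := tauw e w v.

Definition bcoef (e : sgn) w v : Qfield :=
  coord (taubasis e) (enum_rank v) (tdelta Qaction w).

Definition QWdual := 'Hom(QW, Qfield^o).

Definition fd w : QWdual := linfun (fun z : QW => z w : Qfield^o).

Definition taudual (e : sgn) w : QWdual :=
  linfun (fun z : QW => coord (taubasis e) (enum_rank w) z : Qfield^o).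

(* The Q-linear extensions of p . f_v = v(p) f_v and delta_w . f_v = f_{v w^-1};
   the coordinate of g on f_v is g (delta_v). *)
Definition bulletQ (p : Qfield) (g : QWdual) : QWdual :=
  \sum_v g (tdelta Qaction v) *: (Wact v p *: fd v).
Definition bullet_delta w (g : QWdual) : QWdual :=
  \sum_v g (tdelta Qaction v) *: fd (v * w^-1)%g.
Definition bullet (z : QW) (g : QWdual) : QWdual :=
  \sum_w bulletQ (z w) (bullet_delta w g).

Definition St_plus w : QWdual :=
  bullet (tauw Plus w^-1) (xminus w0 *: fd 1%g).
Definition St_minus w : QWdual :=
  bullet (tauw Minus (w0 * w))^-1 (xminus w0 *: fd w0).

Definition beta l (s : l.-tuple 'I_(nsimple D)) (j : 'I_l) : 'cV[int]_(rk D) :=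
  wmx (word_prod (take j s)) *m simple (tnth s j).

Definition rootpoly (e : sgn) l (s : l.-tuple 'I_(nsimple D)) : hQW :=
  \prod_(j < l) (hat (tau e (tnth s j)) -
                 iny ((qp - 1) / (1 - ex (beta s j))) *: (1 : hQW)).

Definition is_Kcoef (K : W -> W -> Qfield) : Prop :=
  forall (e : sgn) w (s : (wlen w).-tuple 'I_(nsimple D)), word_prod s = w ->
    rootpoly e s = \sum_(v | bruhat v w) iny (K v w) *: hat (tauw e v).

(* For v <= w the value K v w is determined by is_Kcoef, since the tauw e v form
   a basis; the other values are arbitrary. *)
Definition Kcoef : W -> W -> Qfield :=
  epsilon (inhabits (fun _ _ => 0)) is_Kcoef.

End Weyl.

(* Main.v *)
(* Write tau_i = d_i + F_i with d_i = (q-1)/(1-e^{alpha_i}). The F_i are multiples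
   of the delta_{s_i}: a product of F_i along a reduced word of w is C_w delta_w,
   C_w being a product over Sigma_w, so the F_i satisfy the braid relations, and
   F_i^2 = q + (q-1) d_i - d_i^2 for both signs. Expanding the two alternating
   products of tau_i, tau_j in terms of the F's reduces their braid relation to
   identities between the (q-1)/(1-e^beta), beta in a rank two root system; then
   tau_w is independent of the reduced word and the tau_w multiply as in the
   Hecke algebra.

   Multiplying C_w delta_w = sum_v k_{v,w} tau_v on the right by F_i = tau_i - d_i
   replaces d_i by w(d_i) on the left, which is exactly the recursion satisfied by
   the coefficients of the root polynomials. Hence K_{v,w} = k_{v,w} = C_w b_{w,v}
   for either sign.

   The action on the dual is (z . g)(y) = g(y z). So (1) is read off from the
   coefficients of tau^+_{w^-1}, and the first equality of (2) says that the
   coefficient of tau_{w0} in q_u tau_v tau_u^{-1} is 1 if v = w0 u and 0 otherwise,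
   which follows by induction on u. *)
Require Import Defs.
From mathcomp Require Import all_boot all_order all_fingroup all_algebra.
From HB Require Import structures.
From Stdlib Require Import ClassicalEpsilon.
From mathcomp Require Import ring zify.

Set Implicit Arguments.
Unset Strict Implicit.
Unset Printing Implicit Defensive.

Import Order.TTheory GRing.Theory Num.Theory.
Local Open Scope ring_scope.

(** * Roots, lengths and the exchange property *)

Section RootCombinatorics.
Variables (D : root_datum) (W : weyl_group D).
Implicit Types (u v w x y : W) (a b g : 'cV[int]_(rk D)) (i j k : 'I_(nsimple D)).

(** The obstacle is the braid relation: the $F_i$ are only semilinear, so expanding an alternating
    product of $\tau$'s twists every coefficient obtained so far. These coefficients are universal
    formulas in the finitely many values $d(\beta)=(q-1)/(1-e^\beta)$, $\beta$ a positive root of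
    rank two, and a simple reflection permutes these values except at its own root, where $d$
    becomes $(q-1)-d$. Carrying formulas instead of values gives a recursion on the dihedral polygon
    that mentions neither the sign nor the group. Finiteness of $W$ leaves four Cartan types, each a
    finite list of identities between rational functions in three variables. For $\mathrm{St}^-$,
    evaluation at $\delta_{w_0}$ suffices: $\tau_{w_0}$ is the only $\tau_v$ with a $\delta_{w_0}$
    term, its coefficient is $C_{w_0}$, and $x_{-w_0}C_{w_0}=\hat x_{w_0}$ for the minus sign. The
    Coxeter facts needed (exchange, Bruhat lifting) are derived from the root datum and the
    faithfulness of $W$. *)

Definition rpos a := a \in posroots D.
Local Notation Roots := (Defs.roots D).
Local Notation s_ i := (srefl W i).

Lemma mem_roots a : (a \in Roots) = rpos a || rpos (- a).
Proof.
rewrite /Defs.roots mem_cat; congr (_ || _); apply/mapP/idP => [[b bp ->]|ap].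
  by rewrite /rpos opprK.
by exists (- a); rewrite ?opprK.
Qed.

Lemma mem_negroots a : (a \in negroots D) = rpos (- a).
Proof.
apply/mapP/idP => [[b bp ->]|ap]; first by rewrite /rpos opprK.
by exists (- a); rewrite ?opprK.
Qed.

Lemma rposN a : rpos a -> ~~ rpos (- a).
Proof.
move=> ap; apply/negP => nap; have := roots_uniq D.
rewrite cat_uniq => /and3P[_ /hasPn H _].
have /H/negP : - a \in [seq - b | b <- posroots D] by apply: map_f.
exact.
Qed.

Lemma rposNE a : a \in Roots -> rpos (- a) = ~~ rpos a.
Proof.
rewrite mem_roots; case: (boolP (rpos a)) => [/rposN/negbTE //|_ /= ->//].
Qed.

Lemma rpos_root a : rpos a -> a \in Roots.
Proof. by rewrite mem_roots => ->. Qed.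

Lemma mem_rootsN a : (- a \in Roots) = (a \in Roots).
Proof. by rewrite !mem_roots opprK orbC. Qed.

Lemma simple_root i : simple i \in Roots.
Proof. exact/rpos_root/simple_pos. Qed.

Lemma root_neq0 a : a \in Roots -> a != 0.
Proof.
move=> ar; apply/eqP => a0; move: (coroot_pair ar); rewrite a0 mulmx0.
by move/matrixP/(_ 0 0); rewrite !mxE.
Qed.

Definition pairing a b : int := (coroot a *m b) 0 0.

Lemma reflmxE a b : reflmx a (coroot a) *m b = b - pairing a b *: a.
Proof.
rewrite /reflmx mulmxBl mul1mx -mulmxA; congr (_ - _).
apply/colP => i; rewrite !mxE big_ord1 mulrC; congr (_ * _).
Qed.

Lemma srefl_act i b : wmx (s_ i) *m b = b - pairing (simple i) b *: simple i.
Proof. by rewrite wmx_srefl reflmxE. Qed.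

Lemma pairingxx a : a \in Roots -> pairing a a = 2%:Z.
Proof. by rewrite /pairing => /coroot_pair ->; rewrite mxE. Qed.

Lemma pairingD a b c : pairing a (b + c) = pairing a b + pairing a c.
Proof. by rewrite /pairing mulmxDr mxE. Qed.

Lemma pairingZ a n b : pairing a (n *: b) = n * pairing a b.
Proof. by rewrite /pairing -scalemxAr mxE. Qed.

Lemma srefl_simple i : wmx (s_ i) *m simple i = - simple i.
Proof.
rewrite srefl_act pairingxx ?simple_root //.
by rewrite -[X in X - _]scale1r -scalerBl -scaleN1r.
Qed.

Lemma sreflK i : (s_ i * s_ i = 1)%g.
Proof.
apply: (@wmx_inj _ W); rewrite wmxM wmx1.
apply/trmx_inj/row_matrixP => k; rewrite -!tr_col; congr trmx.
rewrite !colE -mulmxA mul1mx !srefl_act pairingD -scaleNr pairingZ.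
rewrite pairingxx ?simple_root // -addrA -scalerBl.
by rewrite (_ : _ - _ = 0) ?scale0r ?addr0 //; lia.
Qed.

Lemma sreflV i : ((s_ i)^-1 = s_ i)%g.
Proof. by apply: (mulgI (s_ i)); rewrite mulgV sreflK. Qed.

Lemma wmx_act1 a : wmx (1%g : W) *m a = a.
Proof. by rewrite wmx1 mul1mx. Qed.

Lemma wmx_actM u v a : wmx (u * v)%g *m a = wmx u *m (wmx v *m a).
Proof. by rewrite wmxM mulmxA. Qed.

Lemma wmx_actK u a : wmx u^-1%g *m (wmx u *m a) = a.
Proof. by rewrite -wmx_actM mulVg wmx_act1. Qed.

Lemma wmx_actVK u a : wmx u *m (wmx u^-1%g *m a) = a.
Proof. by rewrite -wmx_actM mulgV wmx_act1. Qed.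

Lemma wmx_eq u v : (forall a, wmx u *m a = wmx v *m a) -> u = v.
Proof.
move=> E; apply: (@wmx_inj _ W).
apply/trmx_inj/row_matrixP => k; rewrite -!tr_col; congr trmx.
by rewrite !colE E.
Qed.

Lemma word_cons i s : word_prod W (i :: s) = (s_ i * word_prod W s)%g.
Proof. by rewrite /word_prod big_cons. Qed.

Lemma word_nil : word_prod W [::] = 1%g.
Proof. by rewrite /word_prod big_nil. Qed.

Lemma word_cat s1 s2 : word_prod W (s1 ++ s2) = (word_prod W s1 * word_prod W s2)%g.
Proof. by rewrite /word_prod big_cat. Qed.

Lemma word_rcons s i : word_prod W (rcons s i) = (word_prod W s * s_ i)%g.
Proof. by rewrite -cats1 word_cat word_cons word_nil mulg1. Qed.

Lemma wordP w : exists s, word_prod W s = w /\ size s = wlen w.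
Proof.
exists (redword w); split; last by rewrite size_tuple.
exact/eqP/(xchooseP (redword_exists w)).
Qed.

Lemma wlen_word s : (wlen (word_prod W s) <= size s)%N.
Proof.
rewrite /wlen; case: ex_minnP => n _; apply; apply/existsP.
by exists (in_tuple s).
Qed.

Lemma W_ind (P : W -> Prop) :
  P 1%g -> (forall i w, P w -> P (s_ i * w)%g) -> forall w, P w.
Proof.
move=> P1 PM w; have [s [<- _]] := wordP w.
by elim: s => [|i s IH]; rewrite ?word_nil ?word_cons //; apply: PM.
Qed.

Lemma wmx_root w a : (wmx w *m a \in Roots) = (a \in Roots).
Proof.
have H u b : b \in Roots -> wmx u *m b \in Roots.
  elim/W_ind: u => [|i u IH] br; first by rewrite wmx_act1.
  rewrite wmx_actM wmx_srefl; apply: reflmx_root (IH br); exact: simple_root.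
by apply/idP/idP => [/(H w^-1%g)|/H//]; rewrite wmx_actK.
Qed.

Lemma wmxN w a : wmx w *m - a = - (wmx w *m a).
Proof. exact: mulmxN. Qed.

(** Adding the expansion of [- a] with natural coefficients [n] gives a vanishing combination, so
    freeness forces [c k = - n k]. *)
Lemma posN_coef a (c : 'I_(nsimple D) -> int) k :
    a = \sum_i c i *: simple i -> rpos (- a) ->
  c k <= 0.
Proof.
move=> ac /posroots_simple[n nE].
have /simple_free/(_ k) : \sum_i (c i + (n i)%:Z) *: simple i = 0.
  transitivity (a - a); last exact: subrr.
  rewrite [in RHS]nE [X in X + _]ac -big_split /=; apply: eq_bigr => i _.
  by rewrite scalerDl -[(n i)%:Z]natz scaler_nat.
by lia.
Qed.

Lemma pos_coef a (c : 'I_(nsimple D) -> int) k :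
    a = \sum_i c i *: simple i -> rpos a ->
  0 <= c k.
Proof.
move=> ac ap; rewrite -oppr_le0.
apply: (@posN_coef (- a) (fun i => - c i)); rewrite ?opprK //.
by rewrite ac -sumrN; apply: eq_bigr => i _; rewrite scaleNr.
Qed.

(** Since the root system is reduced, [a] has a positive coefficient at some simple root other than
    [simple i]. The reflection changes only the coefficient of [simple i], so the image cannot be
    negative. *)
Lemma srefl_pos i a : rpos a -> a != simple i -> rpos (wmx (s_ i) *m a).
Proof.
move=> ap na; have [c cE] := posroots_simple ap.
have sr : wmx (s_ i) *m a \in Roots by rewrite wmx_root rpos_root.
apply: contraT => np; have {np sr} np : rpos (- (wmx (s_ i) *m a)).
  by rewrite rposNE.
have [k /andP[ki ck]] : exists k, (k != i) && (0 < c k)%N.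
  apply/existsP; apply: contraT; rewrite negb_exists => /forallP H.
  have aE : a = (c i)%:Z *: simple i.
    rewrite {1}cE (bigD1 i) //= big1 ?addr0 => [|k ki].
      by rewrite -[(c i)%:Z]natz scaler_nat.
    by move: (H k); rewrite ki /= -eqn0Ngt => /eqP ->.
  case: (@roots_reduced D a (simple i) 1 (c i)%:Z).
  - exact: rpos_root.
  - exact: simple_root.
  - by [].
  - by rewrite scale1r.
  - by move=> e; rewrite e eqxx in na.
  - by move=> e; move: (simple_pos i); rewrite e -/(rpos _) (negbTE (rposN ap)).
have := @posN_coef (wmx (s_ i) *m a)
   (fun j => (c j)%:Z - (if j == i then pairing (simple i) a else 0)) k.
rewrite (negbTE ki) => /(_ _ np); rewrite subr0 => H.
suff /H : wmx (s_ i) *m a = \sum_j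
   ((c j)%:Z - (if j == i then pairing (simple i) a else 0)) *: simple j by lia.
rewrite srefl_act {1}cE.
under [RHS]eq_bigr => j _ do rewrite scalerBl.
rewrite sumrB; congr (_ - _).
  by apply: eq_bigr => j _; rewrite -[(c j)%:Z]natz scaler_nat.
rewrite (bigD1 i) //= eqxx big1 ?addr0 // => j /negbTE ->.
by rewrite scale0r.
Qed.

(** The functional [f] is left free: for a conjugate of a simple reflection it is a transported
    coroot, not known to be the [coroot] of [g]. *)
Definition is_refl (t : W) g := 
  exists f : 'rV[int]_(rk D), wmx t = 1%:M - g *m f /\ f *m g = 2%:M.

(* A product of two reflections in the same root is unipotent, hence trivial in
   a finite group. *)
Lemma is_refl_uniq t1 t2 g : g != 0 -> is_refl t1 g -> is_refl t2 g -> t1 = t2.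
Proof.
move=> g0 [f1 [E1 p1]] [f2 [E2 p2]].
have [h hE] : exists h, h = f1 - f2 by exists (f1 - f2).
have hg : h *m g = 0 by rewrite hE mulmxBl p1 p2 subrr.
have E : wmx (t1 * t2)%g = 1%:M - g *m h.
  rewrite wmxM E1 E2 mulmxBl mul1mx mulmxBr mulmx1.
  rewrite mulmxA -(mulmxA g f1 g) p1 mul_mx_scalar -scalemxAl scaler_nat mulr2n.
  by rewrite hE mulmxBr !opprB !addrA subrK.
have En n : wmx ((t1 * t2) ^+ n)%g = 1%:M - (n%:Z *: (g *m h)).
  elim: n => [|n IH]; first by rewrite expg0 wmx1 scale0r subr0.
  rewrite expgS wmxM E IH mulmxBl mul1mx mulmxBr mulmx1 -scalemxAr.
  rewrite mulmxA -(mulmxA g h g) hg mulmx0 mul0mx scaler0 subr0.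
  by rewrite -addrA -opprD -{2}[g *m h]scale1r -scalerDl; congr (_ - _ *: _); lia.
have gh0 : g *m h = 0.
  have := En #[t1 * t2]%g; rewrite expg_order wmx1 => /eqP.
  rewrite -subr_eq0 opprB addrCA subrr addr0 scalemx_eq0 => /orP[|/eqP//].
  by have := order_gt0 (t1 * t2)%g; lia.
have : (t1 * t2 = 1)%g by apply: (@wmx_inj _ W); rewrite E gh0 subr0 wmx1.
move=> H; apply: (mulIg t2); rewrite H.
suff : (t2 * t2 = 1)%g by [].
apply: (@wmx_inj _ W); rewrite wmxM E2 wmx1 mulmxBl mul1mx mulmxBr mulmx1.
rewrite mulmxA -(mulmxA g f2 g) p2 mul_mx_scalar -scalemxAl scaler_nat mulr2n.
by rewrite opprB addrK subrK.
Qed.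

Lemma is_refl_conj x i : is_refl (s_ i ^ x^-1)%g (wmx x *m simple i).
Proof.
exists (coroot (simple i) *m wmx x^-1%g); split.
  rewrite conjgE invgK !wmxM wmx_srefl /reflmx mulmxBl mul1mx mulmxBr.
  by rewrite -wmxM mulgV wmx1 !mulmxA.
rewrite mulmxA -(mulmxA _ (wmx x^-1%g)) -wmxM mulVg wmx1 mulmx1.
by rewrite coroot_pair ?simple_root.
Qed.

Lemma is_reflN t g : is_refl t g -> is_refl t (- g).
Proof.
case=> f [E p]; exists (- f); rewrite mulmxN !mulNmx mulmxN !opprK.
by split.
Qed.

Lemma refl_eq x y i k :
    wmx x *m simple i = wmx y *m simple k \/
    wmx x *m simple i = - (wmx y *m simple k) ->
  (s_ i ^ x^-1 = s_ k ^ y^-1)%g.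
Proof.
move=> E; apply: (@is_refl_uniq _ _ (wmx x *m simple i)).
- by apply: root_neq0; rewrite wmx_root simple_root.
- exact: is_refl_conj.
- by case: E => ->; [|apply: is_reflN]; apply: is_refl_conj.
Qed.

(** As the letters of [s] act from the right, some letter [i] makes the image of [g] change sign;
    [simple i] is the only positive root that [s_i] makes negative. *)
Lemma exchange s g : rpos g -> ~~ rpos (wmx (word_prod W s) *m g) ->
  exists s1 i s2, s = s1 ++ i :: s2 /\ wmx (word_prod W s2) *m g = simple i.
Proof.
move=> gp; elim: s => [|i s IH]; first by rewrite word_nil wmx_act1 gp.
rewrite word_cons wmx_actM.
case: (boolP (rpos (wmx (word_prod W s) *m g))) => [sg|/IH].
  case: (eqVneq (wmx (word_prod W s) *m g) (simple i)) => [e _|ne].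
    by exists [::], i, s.
  by rewrite (srefl_pos sg ne).
by move=> [s1 [k [s2 [-> e]]]] _; exists (i :: s1), k, s2.
Qed.

(** The hypothesis says that the reflection on the right, moved to the left of [s2], becomes [s_i];
    there it cancels the letter [i]. *)
Lemma word_delete s1 i s2 x k : 
    wmx (word_prod W s2) *m (wmx x *m simple k) = simple i \/
    wmx (word_prod W s2) *m (wmx x *m simple k) = - simple i ->
  (word_prod W (s1 ++ i :: s2) * s_ k ^ x^-1 = word_prod W (s1 ++ s2))%g.
Proof.
move=> e; rewrite !word_cat word_cons -!mulgA; congr (_ * _)%g.
have -> : (s_ k ^ x^-1 = s_ i ^ (word_prod W s2))%g.
  rewrite -[word_prod W s2]invgK; apply: refl_eq.
  by case: e => e; [left|right]; rewrite -?wmxN -e wmx_actK.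
by rewrite conjgE !mulgA mulgK sreflK mul1g.
Qed.

(** * Length as the number of inversions *)

Definition ninv w := count (fun a => ~~ rpos (wmx w *m a)) (posroots D).

Lemma posroots_uniq : uniq (posroots D).
Proof. by have := roots_uniq D; rewrite cat_uniq => /andP[]. Qed.

(** By [srefl_pos], [s_i] permutes the positive roots other than [simple i]. This form lets the
    inversions of [w * s_i] be counted through those of [w]. *)
Lemma posroots_perm i :
  perm_eq (posroots D)
    (simple i :: [seq wmx (s_ i) *m a | a <- rem (simple i) (posroots D)]).
Proof.
have pu := posroots_uniq.
have injs : injective (mulmx (wmx (s_ i)) : 'cV_(rk D) -> 'cV_(rk D)).
  exact: wmx_mul_inj.
apply: (perm_trans (perm_to_rem (simple_pos i))); rewrite perm_cons perm_sym.
apply: uniq_perm; rewrite ?map_inj_uniq ?rem_uniq //.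
have H a : a \in rem (simple i) (posroots D) ->
   wmx (s_ i) *m a \in rem (simple i) (posroots D).
  rewrite !mem_rem_uniq // !inE => /andP[na ap]; rewrite [_ \in _]srefl_pos // andbT.
  apply: contraL ap => /eqP e.
  have -> : a = - simple i.
    by rewrite -[a]wmx_act1 -(sreflK i) wmx_actM e srefl_simple.
  by apply: rposN; apply: simple_pos.
move=> a; apply/mapP/idP => [[b /H bp ->]//|/H ap].
by exists (wmx (s_ i) *m a) => //; rewrite -wmx_actM sreflK wmx_act1.
Qed.

Lemma ninv_srefl w i : rpos (wmx w *m simple i) -> ninv (w * s_ i) = (ninv w).+1.
Proof.
move=> wi; rewrite {1}/ninv (seq.permP (posroots_perm i)) /= wmx_actM srefl_simple.
rewrite wmxN rposNE ?wmx_root ?simple_root // wi /= add1n; congr S.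
rewrite count_map /ninv (seq.permP (perm_to_rem (simple_pos i))) /= wi add0n.
by apply: eq_count => a /=; rewrite wmx_actM -[in LHS](wmx_actM (s_ i)) sreflK wmx_act1.
Qed.

Lemma ninv1 : ninv 1 = 0%N.
Proof.
apply/eqP; rewrite eqn0Ngt -has_count; apply/hasPn => a ap.
by rewrite wmx_act1 negbK.
Qed.

Lemma wlen1 : wlen (1%g : W) = 0%N.
Proof. by apply/eqP; rewrite -leqn0 -word_nil (leq_trans (wlen_word _)). Qed.

Definition reduced s := wlen (word_prod W s) == size s.

Lemma reduced_redword w : reduced (redword w).
Proof.
rewrite /reduced size_tuple; apply/eqP; congr wlen.
exact/eqP/(xchooseP (redword_exists w)).
Qed.

Lemma reduced_catl s1 s2 : reduced (s1 ++ s2) -> reduced s1.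
Proof.
rewrite /reduced eqn_leq => /andP[_]; rewrite size_cat word_cat => H.
rewrite eqn_leq wlen_word /= leqNgt; apply/negP => lt.
have [r1 [e1 z1]] := wordP (word_prod W s1).
have := wlen_word (r1 ++ s2); rewrite word_cat e1 size_cat z1 => H2.
by have := leq_trans H H2; rewrite leq_add2r leqNgt lt.
Qed.

Lemma reduced_catr s1 s2 : reduced (s1 ++ s2) -> reduced s2.
Proof.
rewrite /reduced eqn_leq => /andP[_]; rewrite size_cat word_cat => H.
rewrite eqn_leq wlen_word /= leqNgt; apply/negP => lt.
have [r1 [e1 z1]] := wordP (word_prod W s2).
have := wlen_word (s1 ++ r1); rewrite word_cat e1 size_cat z1 => H2.
by have := leq_trans H H2; rewrite leq_add2l leqNgt lt.
Qed.

(** Otherwise the exchange property deletes a letter of [s], and the product of [rcons s i] has a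
    word shorter by two. *)
Lemma reduced_rcons_pos s i :
  reduced (rcons s i) -> rpos (wmx (word_prod W s) *m simple i).
Proof.
move=> red; apply: contraT => np.
have [s1 [k [s2 [sE e]]]] := exchange (simple_pos i) np.
have := @word_delete s1 k s2 1%g i.
rewrite wmx_act1 invg1 conjg1 -sE => /(_ (or_introl e)).
rewrite -word_rcons => H; move: red; rewrite /reduced H.
by have := wlen_word (s1 ++ s2); rewrite size_rcons sE !size_cat /=; lia.
Qed.

Lemma ninv_reduced s : reduced s -> ninv (word_prod W s) = size s.
Proof.
elim/last_ind: s => [_|s i IH red]; first by rewrite word_nil ninv1.
rewrite word_rcons ninv_srefl ?reduced_rcons_pos // IH ?size_rcons //.
by move: red; rewrite -cats1 => /reduced_catl.
Qed.

Lemma wlenE w : wlen w = ninv w.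
Proof.
have [s [<- e]] := wordP w; rewrite ninv_reduced -?e //.
by rewrite /reduced e.
Qed.

Lemma wlen_srefl w i : rpos (wmx w *m simple i) -> wlen (w * s_ i) = (wlen w).+1.
Proof. by rewrite !wlenE; apply: ninv_srefl. Qed.

Lemma wlen_sreflN w i : ~~ rpos (wmx w *m simple i) -> wlen w = (wlen (w * s_ i)).+1.
Proof.
move=> np; rewrite -(@wlen_srefl _ i); first by rewrite -mulgA sreflK mulg1.
by rewrite wmx_actM srefl_simple wmxN rposNE ?wmx_root ?simple_root.
Qed.

Lemma wlen_lt_srefl w i : (wlen w < wlen (w * s_ i))%N = rpos (wmx w *m simple i).
Proof.
by case: (boolP (rpos _)) => [/wlen_srefl ->//|/wlen_sreflN ->]; [rewrite ltnSn|lia].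
Qed.

Lemma wlenV w : wlen w^-1 = wlen w.
Proof.
have H u : (wlen u^-1 <= wlen u)%N.
  have [s [<- <-]] := wordP u; rewrite -(size_rev s).
  suff -> : ((word_prod W s)^-1 = word_prod W (rev s))%g by apply: wlen_word.
  elim: s => [|i s IH]; first by rewrite /rev /= word_nil invg1.
  by rewrite rev_cons word_rcons -IH word_cons invMg sreflV.
by apply/eqP; rewrite eqn_leq H -{1}[w]invgK H.
Qed.

Lemma wlen_eq0 w : wlen w = 0%N -> w = 1%g.
Proof. by have [s [<- <-]] := wordP w => /size0nil ->; rewrite word_nil. Qed.

Lemma reduced_rconsE s i :
  reduced (rcons s i) = reduced s && rpos (wmx (word_prod W s) *m simple i).
Proof.
apply/idP/andP => [red|[red p]].
  by split; [move: red; rewrite -cats1 => /reduced_catl|apply: reduced_rcons_pos].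
by rewrite /reduced word_rcons wlen_srefl // size_rcons eqSS.
Qed.

Lemma exists_descent w : w != 1%g -> exists i, ~~ rpos (wmx w *m simple i).
Proof.
have [s [<- z]] := wordP w; case: (lastP s) z => [|s' i] z.
  by rewrite word_nil eqxx.
move=> _; exists i; rewrite -wlen_lt_srefl -leqNgt -z word_rcons -mulgA sreflK mulg1.
by rewrite size_rcons (leq_trans (wlen_word s')).
Qed.

(** A nontrivial element has a right descent, so it is reached from a shorter one by a right ascent;
    the recursions for $C_w$, $\tau_w$ and $K_{v,w}$ all have this shape. *)
Lemma wlen_ind (P : W -> Prop) : P 1%g ->
  (forall w i, rpos (wmx w *m simple i) -> P w -> P (w * s_ i)%g) -> forall w, P w.
Proof.
move=> P1 PM w; have [n] := ubnP (wlen w); elim: n w => // n IH w.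
have [-> //|/exists_descent[i ni]] := eqVneq w 1%g.
rewrite (wlen_sreflN ni) ltnS => /IH H.
have -> : w = (w * s_ i * s_ i)%g by rewrite -mulgA sreflK mulg1.
apply: PM => //.
by rewrite wmx_actM srefl_simple wmxN rposNE ?wmx_root ?simple_root.
Qed.

End RootCombinatorics.

(** * Bruhat order, longest element and inversion sets *)

Section Bruhat.
Variables (D : root_datum) (W : weyl_group D).
Implicit Types (u v w x y : W) (a b g : 'cV[int]_(rk D)) (i j k : 'I_(nsimple D)).
Local Notation Roots := (Defs.roots D).
Local Notation s_ i := (srefl W i).

(** Unlike [rpos], this is stable under addition. *)
Definition poscone a := exists c : 'I_(nsimple D) -> nat, a = \sum_i simple i *+ c i.

Lemma poscone0 : poscone 0.
Proof. by exists (fun=> 0%N); rewrite big1. Qed.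

Lemma posconeD a b : poscone a -> poscone b -> poscone (a + b).
Proof.
move=> [c ->] [d ->]; exists (fun i => c i + d i)%N.
by rewrite -big_split /=; apply: eq_bigr => i _; rewrite mulrnDr.
Qed.

Lemma posconeMn a n : poscone a -> poscone (a *+ n).
Proof.
move=> ca; elim: n => [|n IH]; first exact: poscone0.
by rewrite mulrS; apply: posconeD.
Qed.

Lemma rpos_poscone a : rpos a -> poscone a.
Proof. exact: posroots_simple. Qed.

Lemma poscone_antisym a : poscone a -> poscone (- a) -> a = 0.
Proof.
move=> [c ca] [d da].
have sum0 : \sum_i (c i + d i)%:Z *: simple i = 0 :> 'cV[int]_(rk D).
  transitivity (a - a); last exact: subrr.
  rewrite [in RHS]da [X in X + _]ca -big_split /=; apply: eq_bigr => i _.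
  by rewrite -natz scaler_nat mulrnDr.
rewrite ca big1 // => i _; have := simple_free sum0 i.
by case: (c i).
Qed.

Lemma rposN_poscone a : a \in Roots -> poscone (- a) -> ~~ rpos a.
Proof.
move=> ar na; apply: contraT; rewrite negbK => /rpos_poscone ap.
by have := root_neq0 ar; rewrite (poscone_antisym ap na) eqxx.
Qed.

Lemma rpos_of_poscone a : a \in Roots -> poscone a -> rpos a.
Proof.
move=> ar ap; have := @rposN_poscone (- a).
rewrite mem_rootsN opprK => /(_ ar ap); rewrite rposNE ?mem_rootsN //.
by rewrite negbK.
Qed.

Lemma rposN_of_simple w a : (forall i, ~~ rpos (wmx w *m simple i)) -> rpos a ->
  ~~ rpos (wmx w *m a).
Proof.
move=> wN ap; apply: rposN_poscone; first by rewrite wmx_root rpos_root.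
have [c ->] := posroots_simple ap; rewrite mulmx_sumr -sumrN.
elim/big_ind: _ => [||i _]; [exact: poscone0|exact: posconeD|].
rewrite -scaler_nat -scalemxAr scaler_nat -mulNrn; apply/posconeMn/rpos_poscone.
by rewrite rposNE ?wN // wmx_root simple_root.
Qed.

(** Here [g] is the positive root of the reflection [t]. If [u] makes [g] negative, exchange deletes
    a letter from a reduced word of [u] to give [u t]; otherwise the same applies to [u t], because
    [t] negates [g]. *)
Lemma wlen_refl_lt u x i g : rpos g ->
    g = wmx x^-1%g *m simple i \/ g = - (wmx x^-1%g *m simple i) ->
  (wlen u < wlen (u * s_ i ^ x)%g)%N = rpos (wmx u *m g).
Proof.
move=> gp gE.
have tg : wmx (s_ i ^ x)%g *m g = - g.
  rewrite conjgE !wmx_actM; case: gE => ->.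
    by rewrite wmx_actVK srefl_simple wmxN.
  by rewrite !wmxN wmx_actVK srefl_simple wmxN.
have tK : (s_ i ^ x * s_ i ^ x = 1)%g by rewrite -conjMg sreflK conj1g.
have lt v : ~~ rpos (wmx v *m g) -> (wlen (v * s_ i ^ x)%g < wlen v)%N.
  have [s [<- z]] := wordP v; move=> /(exchange gp)[s1 [k [s2 [sE e]]]].
  have := @word_delete _ W s1 k s2 x^-1%g i.
  rewrite invgK -sE => ->.
    by rewrite -z sE (leq_ltn_trans (wlen_word W _)) // !size_cat /= addnS.
  by case: gE e => ->; rewrite ?wmxN => e; [left|right; rewrite -e opprK].
case: (boolP (rpos (wmx u *m g))) => [ug|/lt]; last by case: ltngtP.
have /lt : ~~ rpos (wmx (u * s_ i ^ x)%g *m g).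
  by rewrite wmx_actM tg wmxN rposN.
by rewrite -mulgA tK mulg1.
Qed.

Lemma bruhat_refl u : bruhat u u.
Proof. exact: connect0. Qed.

Lemma bruhat_trans : transitive (@bruhat D W).
Proof. exact: connect_trans. Qed.

Lemma bruhat_srefl u i : rpos (wmx u *m simple i) -> bruhat u (u * s_ i)%g.
Proof.
move=> up; apply: connect1; rewrite /bruhat_step wlen_lt_srefl up /=.
by apply/existsP; exists 1%g; apply/existsP; exists i; rewrite conjg1.
Qed.

(** Induction along a Bruhat chain. Let [g] be the positive root of its first step, from [u] to
    [u1]. If [g = simple i] then [u * s_i = u1]; otherwise [s_i] keeps [g] positive, and conjugating
    the step by [s_i] gives a step from [u * s_i] to [u1 * s_i]. *)
Lemma bruhat_mul_srefl u v i :
  bruhat u v -> bruhat (u * s_ i)%g v || bruhat (u * s_ i)%g (v * s_ i)%g.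
Proof.
move=> /connectP[p]; elim: p u => [|u1 p IH] u /=.
  by move=> _ ->; rewrite bruhat_refl orbT.
move=> /andP[/andP[lt /existsP[x /existsP[k /eqP u1E]]] pth] vE.
have uv : bruhat u1 v by apply/connectP; exists p.
pose b := wmx x^-1%g *m simple k.
have br : b \in Roots by rewrite wmx_root simple_root.
have [g gp gE] : exists2 g, rpos g & g = b \/ g = - b.
  case: (boolP (rpos b)) => bp; first by exists b; [|left].
  by exists (- b); [rewrite rposNE|right].
rewrite u1E (wlen_refl_lt _ gp gE) in lt.
have [gi|gi] := eqVneq g (simple i).
  have tE : (s_ k ^ x = s_ i)%g.
    rewrite -[x]invgK -[s_ i]conjg1 -[in RHS]invg1.
    apply: refl_eq; rewrite wmx_act1 -/b -gi.
    by case: gE => ->; [left|right; rewrite opprK].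
  by rewrite -tE -u1E uv.
have st : bruhat (u * s_ i)%g (u1 * s_ i)%g.
  apply: connect1; rewrite /bruhat_step.
  have E : (u1 * s_ i = u * s_ i * s_ k ^ (x * s_ i))%g.
    by rewrite u1E conjgM [(_ ^ s_ i)%g]conjgE sreflV !mulgA -(mulgA u (s_ i) (s_ i)) sreflK mulg1.
  apply/andP; split; last by apply/existsP; exists (x * s_ i)%g; apply/existsP; exists k; rewrite E.
  rewrite E (@wlen_refl_lt _ _ _ (wmx (s_ i) *m g)) ?srefl_pos //.
    by rewrite -!wmx_actM -mulgA sreflK mulg1.
  rewrite invMg sreflV wmx_actM -/b; case: gE => ->; [by left|right].
  by rewrite wmxN.
by case/orP: (IH u1 pth vE) => H; rewrite (bruhat_trans st H) ?orbT.
Qed.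

Lemma bruhat_lift u v i : rpos (wmx v *m simple i) -> bruhat u v ->
  bruhat u (v * s_ i)%g /\ bruhat (u * s_ i)%g (v * s_ i)%g.
Proof.
move=> vp uv; have vv := bruhat_srefl vp; split.
  exact: bruhat_trans uv vv.
have /orP[H|H] := bruhat_mul_srefl i uv; last exact: H.
exact: (bruhat_trans H vv).
Qed.

Lemma bruhatV u v : bruhat u^-1%g v^-1%g = bruhat u v.
Proof.
have step x y : bruhat_step x y -> bruhat_step x^-1%g y^-1%g.
  move=> /andP[lt /existsP[z /existsP[k /eqP yE]]].
  apply/andP; split; first by rewrite !wlenV.
  (* $(xt)^{-1}=t x^{-1}=x^{-1}(x t x^{-1})$, again a right multiplication by a reflection. *)
  apply/existsP; exists (z * x^-1)%g; apply/existsP; exists k; apply/eqP.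
  rewrite yE invMg -conjVg sreflV conjgM [(_ ^ x^-1)%g]conjgE invgK.
  by rewrite mulKg.
have H x y : bruhat x y -> bruhat x^-1%g y^-1%g.
  move=> /connectP[p]; elim: p x => [|x1 p IH] x /=.
    by move=> _ ->; apply: bruhat_refl.
  move=> /andP[/step st pth] yE.
  exact: bruhat_trans (connect1 st) (IH _ pth yE).
by apply/idP/idP => [/H|/H//]; rewrite !invgK.
Qed.

(** * The longest element and inversion sets *)

Lemma wlen_w0 w : (wlen w <= wlen (w0 W))%N.
Proof. by rewrite /w0; case: arg_maxnP => // x _; apply. Qed.

Lemma w0_simple i : ~~ rpos (wmx (w0 W) *m simple i).
Proof. by rewrite -wlen_lt_srefl -leqNgt wlen_w0. Qed.

Lemma rpos_w0 a : a \in Roots -> rpos (wmx (w0 W) *m a) = ~~ rpos a.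
Proof.
have H b : rpos b -> ~~ rpos (wmx (w0 W) *m b).
  by apply: rposN_of_simple => i; apply: w0_simple.
move=> ar; case: (boolP (rpos a)) => [/H/negbTE //|/=].
rewrite -rposNE // => /H; rewrite wmxN rposNE ?wmx_root //.
by rewrite negbK.
Qed.

(** The longest element exchanges positive and negative roots, so its square has no inversion. *)
Lemma w0K : (w0 W * w0 W = 1)%g.
Proof.
apply: wlen_eq0; rewrite wlenE; apply/eqP; rewrite eqn0Ngt -has_count.
apply/hasPn => a ap; rewrite negbK wmx_actM rpos_w0 ?wmx_root ?rpos_root //.
by rewrite rpos_w0 ?rpos_root // negbK.
Qed.

Lemma w0V : ((w0 W)^-1 = w0 W)%g.
Proof. by apply: (mulgI (w0 W)); rewrite mulgV w0K. Qed.

Lemma mem_Sigma w b : (b \in Sigma_ w) = rpos b && ~~ rpos (wmx w^-1%g *m b).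
Proof.
rewrite mem_filter andbC; case: (boolP (rpos b)) => // bp; last first.
  by rewrite [b \in _](negbTE bp).
rewrite [b \in posroots D]bp -rposNE ?wmx_root ?rpos_root //=.
apply/mapP/idP => [[a an ->]|np].
  by rewrite wmx_actK -mem_negroots.
by exists (wmx w^-1%g *m b); rewrite ?wmx_actVK // mem_negroots.
Qed.

Lemma Sigma_uniq w : uniq (Sigma_ w).
Proof. by rewrite filter_uniq // posroots_uniq. Qed.

Lemma Sigma1 : Sigma_ (1%g : W) = [::].
Proof.
case E: (Sigma_ 1) => [//|b s]; have : b \in Sigma_ (1%g : W) by rewrite E mem_head.
by rewrite mem_Sigma invg1 wmx_act1 andbN.
Qed.

(** For any other positive [b], the root $w^{-1}b$ differs from $\pm\alpha_i$, so [s_i] does not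
    change its sign. *)
Lemma Sigma_srefl w i : rpos (wmx w *m simple i) ->
  perm_eq (Sigma_ (w * s_ i)%g) (wmx w *m simple i :: Sigma_ w).
Proof.
move=> wi; apply: uniq_perm; rewrite /= ?Sigma_uniq ?andbT //.
  by rewrite mem_Sigma wmx_actK [rpos (simple i)]simple_pos andbF.
move=> b; rewrite inE !mem_Sigma invMg sreflV wmx_actM.
have [->|nb] := eqVneq b (wmx w *m simple i).
  by rewrite wi wmx_actK srefl_simple rposN // [rpos _]simple_pos.
case: (boolP (rpos b)) => //= bp; congr (~~ _).
set c := wmx w^-1 *m b; have bE : b = wmx w *m c by rewrite wmx_actVK.
have cr : c \in Roots by rewrite wmx_root rpos_root.
have ci : c != simple i by apply: contraNneq nb => <-; rewrite bE.
have ci' : - c != simple i.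
  apply: contraTneq bp => ci'; rewrite bE -[c]opprK ci' wmxN.
  exact: rposN.
case: (boolP (rpos c)) => cp; first exact: srefl_pos.
have scr : wmx (s_ i) *m c \in Roots by rewrite (wmx_root (s_ i)).
apply: negbTE; rewrite -rposNE // -wmxN; apply: srefl_pos => //.
by rewrite rposNE.
Qed.

Lemma Sigma_w0 : perm_eq (Sigma_ (w0 W)) (posroots D).
Proof.
apply: uniq_perm; rewrite ?Sigma_uniq ?posroots_uniq // => b.
rewrite mem_Sigma w0V; case: (boolP (rpos b)) => /= bp.
  by rewrite rpos_w0 ?rpos_root // bp [RHS]bp.
by rewrite [RHS](negbTE bp).
Qed.

(** A positive root [b] lies in the first or the second part according to the sign of $v^{-1}b$. *)
Lemma Sigma_w0_split v :
  perm_eq (Sigma_ (w0 W))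
    (Sigma_ v ++ [seq wmx v *m b | b <- Sigma_ (v^-1 * w0 W)%g]).
Proof.
have memS b : b \in Sigma_ (v^-1 * w0 W)%g = rpos b && rpos (wmx v *m b).
  rewrite mem_Sigma invMg invgK w0V wmx_actM.
  case: (boolP (rpos b)) => //= bp.
  by rewrite rpos_w0 ?negbK // wmx_root rpos_root.
apply: (perm_trans Sigma_w0); apply: uniq_perm; rewrite ?posroots_uniq //.
  rewrite cat_uniq Sigma_uniq map_inj_uniq ?Sigma_uniq ?andbT /=; last exact: wmx_mul_inj.
  apply/hasPn => x /mapP[b]; rewrite memS => /andP[bp _] ->.
  by rewrite /= mem_Sigma wmx_actK bp andbF.
move=> b; rewrite mem_cat mem_Sigma -/(rpos b); apply/idP/orP => [bp|].
  rewrite bp; case: (boolP (rpos (wmx v^-1%g *m b))) => np; [right|by left].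
  apply/mapP; exists (wmx v^-1%g *m b); rewrite ?wmx_actVK // memS np.
  by rewrite wmx_actVK.
by case=> [/andP[]//|/mapP[c]]; rewrite memS => /andP[_ cp] ->.
Qed.

End Bruhat.

(** * Braid relation in rank two: coefficients *)

(* The dihedral group of order 2m is the 2m-gon 0, 1, ..., 2m-1, vertex 0 being
   the identity and vertex m the longest element; left multiplication by s_true
   (resp. s_false) exchanges the ends of the edge leaving an even (resp. odd)
   vertex upwards. The positive roots are numbered from 0 = alpha_true to
   m-1 = alpha_false in a reflection order. Nat.ltb and eqn (rather than ssrnat's
   <%N and ==) make the definitions reduce by cbv. *)
Definition rk2_adj m (b : bool) (k : nat) : nat :=
  if b (+) odd k then (if eqn k.+1 m.*2 then 0%N else k.+1)
  else if k is k'.+1 then k' else m.*2.-1.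

Definition rk2_up m (b : bool) (k : nat) : bool :=
  if b (+) odd k then Nat.ltb k m else eqn k 0 || Nat.ltb m k.

Definition rk2_root m (b : bool) : nat := if b then 0%N else m.-1.

Definition rk2_alt (b : bool) (n : nat) : seq bool := mkseq (fun k => b (+) odd k) n.

Section RankTwoCoef.
Variables (F : fieldType) (p q : F) (m : nat).
Implicit Types (d : nat -> F) (c : (nat -> F) -> F).

(** In the reflection order [s_true] sends root [k > 0] to root [m - k], and [s_false] sends root
    [k < m - 1] to root [m - 2 - k]. Each negates its own simple root, and [p - d] is the value at
    the opposite root. *)
Definition rk2_refl (b : bool) d : nat -> F := fun k =>
  if b then (if k is 0 then p - d 0%N else d (m - k)%N)
  else if eqn k m.-1 then p - d k else d (m - k.+2)%N.

(* Coefficients are kept as functions of d, on which a reflection acts by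
   permuting the entries of d up to d |-> p - d. *)
Definition rk2_step (b : bool) (st : nat -> (nat -> F) -> F) :
    nat -> (nat -> F) -> F := fun k d =>
  let x := d (rk2_root m b) in
  x * st k d + st (rk2_adj m b k) (rk2_refl b d) *
     (if rk2_up m b k then q + p * x - x ^+ 2 else 1).

Definition rk2_init : nat -> (nat -> F) -> F := fun k _ => if k is 0 then 1 else 0.

Definition rk2_word (s : seq bool) := foldr rk2_step rk2_init s.

(** This expresses that [c] is a universal formula: an endomorphism fixing [p] and [q] acts on its
    value through [d] alone. It absorbs the semilinearity of the operators [f b]. *)
Definition rk2_natural c := forall (f : {rmorphism F -> F}) d d',
  f p = p -> f q = q -> (forall k, (k < m)%N -> f (d k) = d' k) -> f (c d) = c d'.

Lemma rk2_refl_natural (f : {rmorphism F -> F}) d d' b k : f p = p ->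
  (forall k, (k < m)%N -> f (d k) = d' k) -> (k < m)%N ->
  f (rk2_refl b d k) = rk2_refl b d' k.
Proof.
move=> fp fd km; rewrite /rk2_refl; case: b.
  by case: k km => [|k] km; rewrite ?rmorphB /= ?fp fd //; lia.
by case: eqnP => _; rewrite ?rmorphB /= ?fp fd //; lia.
Qed.

Lemma rk2_word_natural s k : (0 < m)%N -> rk2_natural (rk2_word s k).
Proof.
move=> m0; elim: s k => [|b s IH] k f d d' fp fq fd.
  by case: k => [|k]; rewrite ?rmorph1 ?rmorph0.
have fr : f (d (rk2_root m b)) = d' (rk2_root m b).
  by apply: fd; rewrite /rk2_root; case: b; lia.
rewrite /= /rk2_step rmorphD !rmorphM /= fr (IH _ f d d') //.
rewrite (IH _ f _ (rk2_refl b d')) //; last by move=> *; apply: rk2_refl_natural.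
congr (_ + _ * _); case: (rk2_up m b k); last by rewrite rmorph1.
by rewrite rmorphB rmorphXn rmorphD rmorphM /= fr fp fq.
Qed.

End RankTwoCoef.

Section RankTwoBraid.
Variables (F : fieldType) (V : lmodType F) (p q : F) (m : nat) (d : nat -> F).
Variables (s : bool -> {rmorphism F -> F}) (f : bool -> V -> V) (v : V).
Hypothesis m0 : (0 < m)%N.
Hypothesis fD : forall b x y, f b (x + y) = f b x + f b y.
Hypothesis fZ : forall b c x, f b (c *: x) = s b c *: f b x.
Hypothesis f2 : forall b x,
  f b (f b x) = (q + p * d (rk2_root m b) - d (rk2_root m b) ^+ 2) *: x.
Hypothesis sp : forall b, s b p = p.
Hypothesis sq : forall b, s b q = q.
Hypothesis sd : forall b k, (k < m)%N -> s b (d k) = rk2_refl p m b d k.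

(** Vertices below [m] are reached from [v] along one side of the polygon, the others along the
    other side; [fbraid] says that both sides agree at the top vertex [m]. *)
Definition rk2_basis k : V :=
  if (k < m)%N then foldr f v (rev (rk2_alt true k))
  else foldr f v (rev (rk2_alt false (m.*2 - k))).

Hypothesis m4 : m \in [:: 2; 3; 4; 6]%N.
Hypothesis fbraid : foldr f v (rk2_alt true m) = foldr f v (rk2_alt false m).

Lemma rk2_basis_adj b k : (k < m.*2)%N ->
  if rk2_up m b k then rk2_basis (rk2_adj m b k) = f b (rk2_basis k)
  else rk2_basis k = f b (rk2_basis (rk2_adj m b k)).
Proof.
rewrite /rk2_basis; move: m4 fbraid; clear; rewrite !inE.
(* For [m = 6] the polygon has twelve vertices. *)
by case/or4P => /eqP-> fbr; do 12?[case: k => [|k] //]; move=> _; case: b => /=;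
  rewrite ?fbr.
Qed.

Lemma rk2_adj_perm b : perm_eq [seq rk2_adj m b k | k <- iota 0 m.*2] (iota 0 m.*2).
Proof. by move: m4; rewrite !inE => /or4P[]/eqP->; case: b. Qed.

Definition rk2_tau b x := f b x + d (rk2_root m b) *: x.

Lemma f_sum b (I : eqType) (r : seq I) (E : I -> V) :
  f b (\sum_(i <- r) E i) = \sum_(i <- r) f b (E i).
Proof.
apply: (big_morph (f b)); first exact: fD.
by rewrite -[0 in LHS](scale0r v) fZ rmorph0 scale0r.
Qed.

(** Vertex [k] receives the multiple of itself and the image of its neighbour. When the edge goes up
    from [k], the neighbour is already [f b] of it, so [f2] applies and gives the quadratic factor
    of [rk2_step]. *)
Lemma rk2_tau_word r : foldr rk2_tau v r =
  \sum_(k <- iota 0 m.*2) rk2_word p q m r k d *: rk2_basis k.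
Proof.
elim: r => [|b r IH] /=.
  rewrite -[X in iota 0 X]prednK ?double_gt0 //= big_cons scale1r.
  rewrite big1_seq => [|k /andP[_]]; last first.
    by rewrite mem_iota /rk2_init; case: k => [|k]; rewrite ?scale0r.
  by rewrite addr0 /rk2_basis m0.
rewrite /rk2_tau IH f_sum scaler_sumr addrC.
rewrite -[X in _ + X](perm_big _ (rk2_adj_perm b)) big_map -big_split /=.
apply: eq_big_seq => k; rewrite mem_iota /= add0n => km.
rewrite /rk2_step fZ scalerDl scalerA; congr (_ + _).
have fN : s b (rk2_word p q m r (rk2_adj m b k) d) =
    rk2_word p q m r (rk2_adj m b k) (rk2_refl p m b d).
  exact: (@rk2_word_natural F p q m r (rk2_adj m b k) m0 (s b) d _ (sp b) (sq b) (sd b)).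
rewrite fN -scalerA; congr (_ *: _); have := rk2_basis_adj b km.
by case: ifP => _ ->; rewrite ?f2 ?scale1r.
Qed.

Lemma rk2_braid :
    (forall k, (k < m.*2)%N -> rk2_word p q m (rk2_alt true m) k d =
                               rk2_word p q m (rk2_alt false m) k d) ->
  foldr rk2_tau v (rk2_alt true m) = foldr rk2_tau v (rk2_alt false m).
Proof.
move=> H; rewrite !rk2_tau_word; apply: eq_big_seq => k.
by rewrite mem_iota add0n => /H ->.
Qed.

End RankTwoBraid.

(** Types $A_1\times A_1$, $A_2$, $B_2$, $G_2$: absolute values of the two Cartan integers, then the
    positive roots in a reflection order, by their coordinates on the simple roots. *)
Definition rk2_type : seq (nat * nat * seq (nat * nat)) :=
  [:: (0, 0, [:: (1, 0); (0, 1)]);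
      (1, 1, [:: (1, 0); (1, 1); (0, 1)]);
      (2, 1, [:: (1, 0); (2, 1); (1, 1); (0, 1)]);
      (3, 1, [:: (1, 0); (3, 1); (2, 1); (3, 2); (1, 1); (0, 1)])]%N.

Definition rk2_d (F : fieldType) (q t u : F) (rs : seq (nat * nat)) k : F :=
  (q - 1) / (1 - t ^+ (nth (0, 0)%N rs k).1 * u ^+ (nth (0, 0)%N rs k).2).

Lemma rk2_coef (F : fieldType) (q t u : F) X k : X \in rk2_type -> (k < (size X.2).*2)%N ->
    {in X.2, forall r, 1 - t ^+ r.1 * u ^+ r.2 != 0} ->
  let c b := rk2_word (q - 1) q (size X.2) (rk2_alt b (size X.2)) k (rk2_d q t u X.2) in
  c true = c false.
Proof.
move=> + + nz c; rewrite {}/c => X4 km.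
have {nz} : all (fun r => 1 - t ^+ r.1 * u ^+ r.2 != 0) X.2 by apply/allP.
case: X X4 km => ab rs; rewrite !inE => /or4P[]/eqP[_ ->] /=.
all: do 12?[case: k => [|k] //]; move=> _; rewrite ?expr0 ?expr1 ?mulr1 ?mul1r => nz.
(* Only the polygon bookkeeping is unfolded, leaving an identity of rational functions in [q], [t],
   [u]. *)
all: cbv beta iota zeta delta [rk2_d nth rk2_word rk2_alt rk2_step rk2_adj rk2_up
  Nat.ltb Nat.leb orb rk2_refl rk2_root rk2_init mkseq iota map foldr addb odd negb
  eqn subn subn_rec Nat.sub double double_rec predn Nat.pred fst snd].
all: field; move: nz; do ?[case/andP => ->]; by [].
Qed.

(** * Rank two parabolic subgroups *)

Section RankTwoWeyl.
Variables (D : root_datum) (W : weyl_group D).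
Implicit Types (u v w : W) (a b g : 'cV[int]_(rk D)) (i j : 'I_(nsimple D)).
Local Notation Roots := (Defs.roots D).
Local Notation s_ i := (srefl W i).

Definition comb2 i j (c d : int) : 'cV[int]_(rk D) := c *: simple i + d *: simple j.

Lemma comb2_sum i j c d : i != j ->
  comb2 i j c d = \sum_k (if k == i then c else if k == j then d else 0) *: simple k.
Proof.
move=> ij; have ji : (j == i) = false by rewrite eq_sym (negbTE ij).
rewrite (bigD1 i) //= eqxx (bigD1 j) ?ji //= eqxx.
rewrite big1 ?addr0 // => k /andP[/negbTE -> /negbTE ->]; exact: scale0r.
Qed.

Lemma comb2_sign i j c d : i != j -> comb2 i j c d \in Roots ->
  0 <= c /\ 0 <= d \/ c <= 0 /\ d <= 0.
Proof.
move=> ij; rewrite mem_roots; have E := comb2_sum c d ij.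
have ji : (j == i) = false by rewrite eq_sym (negbTE ij).
case/orP => H; [left|right].
  by split; [have := pos_coef i E H|have := pos_coef j E H]; rewrite ?ji eqxx.
by split; [have := posN_coef i E H|have := posN_coef j E H];
  rewrite ?ji eqxx.
Qed.

Lemma comb2_inj i j c d c' d' : i != j -> comb2 i j c d = comb2 i j c' d' ->
  c = c' /\ d = d'.
Proof.
move=> ij E; have E0 : comb2 i j (c - c') (d - d') = 0.
  by rewrite /comb2 !scalerBl addrACA -opprD -/(comb2 _ _ _ _) E subrr.
move: E0; rewrite comb2_sum // => /simple_free H.
split; [have := H i|have := H j]; rewrite ?[j == i]eq_sym ?(negbTE ij) eqxx; lia.
Qed.

Lemma comb2_poscone i j (c d : nat) : poscone (comb2 i j c d).
Proof.
rewrite /comb2 -!natz !scaler_nat; apply: posconeD; apply: posconeMn.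
  exact/rpos_poscone/simple_pos.
exact/rpos_poscone/simple_pos.
Qed.

Definition cartan i j : nat := `|pairing (simple i) (simple j)|.

(** The root $s_i\alpha_j$ has coefficient 1 on $\alpha_j$, hence a nonnegative one on
    $\alpha_i$. *)
Lemma cartanE i j : i != j -> pairing (simple i) (simple j) = - (cartan i j)%:Z.
Proof.
move=> ij; rewrite /cartan; set c := pairing _ _.
have : comb2 i j (- c) 1 \in Roots.
  have := simple_root j; rewrite -(wmx_root (s_ i)) srefl_act -/c.
  by rewrite /comb2 scale1r scaleNr addrC.
by case/(comb2_sign ij); lia.
Qed.

Lemma srefl_comb2l i j (x : 'cV_(rk D)) c d : i != j ->
  wmx (s_ i) *m (x + comb2 i j c d) =
  x + comb2 i j (- pairing (simple i) x - c + (cartan i j)%:Z * d) d.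
Proof.
move=> ij; rewrite srefl_act -addrA; congr (_ + _); rewrite /comb2.
rewrite !pairingD !pairingZ pairingxx ?simple_root // cartanE //.
rewrite addrAC -scalerBl; congr (_ *: _ + _); lia.
Qed.

Lemma comb2C i j c d : comb2 i j c d = comb2 j i d c.
Proof. exact: addrC. Qed.

Lemma srefl_comb2r i j (x : 'cV_(rk D)) c d : i != j ->
  wmx (s_ j) *m (x + comb2 i j c d) =
  x + comb2 i j c (- pairing (simple j) x - d + (cartan j i)%:Z * c).
Proof. by move=> ij; rewrite comb2C srefl_comb2l 1?eq_sym // comb2C. Qed.

Lemma srefl_comb2l0 i j c d : i != j ->
  wmx (s_ i) *m comb2 i j c d = comb2 i j (- c + (cartan i j)%:Z * d) d.
Proof.
move=> ij; have := srefl_comb2l 0 c d ij.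
by rewrite !add0r /pairing mulmx0 mxE oppr0 add0r.
Qed.

Lemma srefl_comb2r0 i j c d : i != j ->
  wmx (s_ j) *m comb2 i j c d = comb2 i j c (- d + (cartan j i)%:Z * c).
Proof. by move=> ij; rewrite comb2C srefl_comb2l0 1?eq_sym // comb2C. Qed.

Lemma simple_comb2l i j : simple i = comb2 i j 1 0.
Proof. by rewrite /comb2 scale1r scale0r addr0. Qed.

Lemma simple_comb2r i j : simple j = comb2 i j 0 1.
Proof. by rewrite /comb2 scale1r scale0r add0r. Qed.

(** If the first integer vanishes, $s_is_j\alpha_i=-\alpha_i+c\,\alpha_j$ with [c = cartan j i], and
    a root has no coefficients of opposite signs. *)
Lemma cartan_eq0 i j : i != j -> cartan i j = 0%N -> cartan j i = 0%N.
Proof.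
move=> ij A0; have : comb2 i j (-1) (cartan j i) \in Roots.
  have := simple_root i; rewrite -(wmx_root (s_ i * s_ j)%g) wmx_actM.
  rewrite (simple_comb2l i j) srefl_comb2r0 // srefl_comb2l0 // A0.
  by rewrite mul0r addr0 mulr1 oppr0 add0r.
by case/(comb2_sign ij); lia.
Qed.

(* Otherwise the orbit of alpha_i under s_i s_j is infinite. *)
Lemma cartan_lt4 i j : i != j -> (cartan i j * cartan j i < 4)%N.
Proof.
move=> ij; rewrite ltnNge; apply/negP => AB.
move EA : (cartan i j) AB => A; move EB : (cartan j i) => B AB.
(* With [4 <= A * B], the bound [2 y < B x] makes the coefficient [x] grow at each application of
   [s_i s_j], and it is preserved. *)
have H n : exists x y : int, [/\ wmx (((s_ i) * (s_ j)) ^+ n)%g *m simple i = comb2 i j x y,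
    n%:Z < x & 2%:Z * y < B%:Z * x].
  elim: n => [|n [x [y [E nx yx]]]].
    exists 1, 0; rewrite expg0 wmx_act1 -simple_comb2l; split=> //; lia.
  exists (A%:Z * (B%:Z * x - y) - x), (B%:Z * x - y).
  have AB4 : 0 <= A%:Z * B%:Z - 4%:Z by lia.
  have A1 : 1 <= A%:Z by lia.
  have Bx : 0 <= B%:Z * x by rewrite mulr_ge0 //; lia.
  have h1 : 0 <= A%:Z * (B%:Z * x - 2%:Z * y - 1) by rewrite mulr_ge0 //; lia.
  have h2 : 0 <= (A%:Z * B%:Z - 4%:Z) * x by rewrite mulr_ge0 //; lia.
  have h3 : 0 <= (A%:Z * B%:Z - 4%:Z) * (B%:Z * x - y) by rewrite mulr_ge0 //; lia.
  split; [|lia|lia].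
  rewrite expgS wmx_actM E wmx_actM srefl_comb2r0 // srefl_comb2l0 //.
  by rewrite EA EB; congr comb2; lia.
have [x [y []]] := H #[s_ i * s_ j]%g.
rewrite expg_order wmx_act1 (simple_comb2l i j) => /(comb2_inj ij)[<- _].
by have := order_gt0 (s_ i * s_ j)%g; lia.
Qed.

(** The alternative is needed because [rk2_type] lists only the pairs whose first entry is at least
    the second. *)
Lemma cartan_type i j : i != j ->
  exists2 X, X \in rk2_type & X.1 = (cartan i j, cartan j i) \/ X.1 = (cartan j i, cartan i j).
Proof.
move=> ij; have := cartan_lt4 ij; have := @cartan_eq0 i j ij.
have := @cartan_eq0 j i; rewrite eq_sym => /(_ ij).
case: (cartan i j) => [|[|[|[|A]]]]; case: (cartan j i) => [|[|[|[|B]]]] // H1 H2 H3;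
  try by [have := H1 erefl|have := H2 erefl].
all: by [exists (nth (0,0,[::])%N rk2_type 0); [|by auto]
       |exists (nth (0,0,[::])%N rk2_type 1); [|by auto]
       |exists (nth (0,0,[::])%N rk2_type 2); [|by auto]
       |exists (nth (0,0,[::])%N rk2_type 3); [|by auto]
       |lia].
Qed.

Section Dihedral.
Variables (i j : 'I_(nsimple D)) (X : nat * nat * seq (nat * nat)).
Hypothesis ij : i != j.
Hypothesis Xtype : X \in rk2_type.
Hypothesis Xij : X.1 = (cartan i j, cartan j i).
Let m := size X.2.

Definition letter (c : bool) := if c then i else j.
Definition dih_word c n := map letter (rk2_alt c n).
Definition dih_root k := comb2 i j (nth (0, 0) X.2 k).1 (nth (0, 0) X.2 k).2.

Lemma dih_braid : word_prod W (dih_word true m) = word_prod W (dih_word false m).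
Proof.
(* Writing [x] as [x + comb2 i j 0 0] lets each reflection change only the two coefficients; what
   remains is linear in the pairings of [x] with the two coroots. *)
apply: wmx_eq => x; rewrite -[x]addr0 -[0](_ : comb2 i j 0 0 = 0); last first.
  by rewrite /comb2 !scale0r addr0.
move: Xtype Xij; rewrite /m /dih_word; case: X => ab rs /=.
rewrite !inE => /or4P[]/eqP[-> ->] [eA eB] /=;
  rewrite !word_cons !word_nil !wmx_actM !wmx_act1 /letter;
  do 6?[rewrite ?(srefl_comb2l, srefl_comb2r) //]; rewrite -?eA -?eB;
  by congr (_ + comb2 _ _ _ _); lia.
Qed.

(** The order of the roots in [rk2_type] is chosen for this: one alternating word meets them in that
    order, the other in the reverse order. *)
Lemma dih_rootE c k : (k < m)%N ->
  wmx (word_prod W (dih_word c k)) *m simple (letter (c (+) odd k)) =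
  dih_root (if c then k else m - k.+1)%N.
Proof.
move: Xtype Xij; rewrite /m /dih_word /dih_root; case: X => ab rs /=.
rewrite !inE => /or4P[]/eqP[-> ->] [eA eB] /=;
do 6?[case: k => [|k] //]; move=> _; case: c => /=;
  rewrite ?word_cons ?word_nil ?wmx_actM ?wmx_act1 /letter /=
    -?(simple_comb2l i j) -?(simple_comb2r i j) //.
all: rewrite ?(simple_comb2l i j) ?(simple_comb2r i j).
all: do 6?[rewrite ?(srefl_comb2l0, srefl_comb2r0) //]; rewrite -?eA -?eB.
all: by congr comb2; lia.
Qed.

Lemma dih_root_pos k : poscone (dih_root k).
Proof. exact: comb2_poscone. Qed.

Lemma dih_root0 : dih_root 0 = simple i.
Proof.
rewrite /dih_root (simple_comb2l i j).
by move: Xtype; case: X => ab rs; rewrite !inE => /or4P[]/eqP[_ ->].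
Qed.

Lemma dih_root_last : dih_root m.-1 = simple j.
Proof.
rewrite /dih_root (simple_comb2r i j) /m.
by move: Xtype; case: X => ab rs; rewrite !inE => /or4P[]/eqP[_ ->].
Qed.

Lemma dih_root_refll k : (0 < k < m)%N ->
  wmx (s_ i) *m dih_root k = dih_root (m - k).
Proof.
rewrite /dih_root srefl_comb2l0 //; move: Xtype Xij; rewrite /m; case: X => ab rs /=.
rewrite !inE => /or4P[]/eqP[-> ->] [<- _] /=;
by do 6?[case: k => [|k] //]; move=> _; congr comb2; lia.
Qed.

Lemma dih_root_reflr k : (k.+1 < m)%N ->
  wmx (s_ j) *m dih_root k = dih_root (m - k.+2).
Proof.
rewrite /dih_root srefl_comb2r0 //; move: Xtype Xij; rewrite /m; case: X => ab rs /=.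
rewrite !inE => /or4P[]/eqP[-> ->] [_ <-] /=;
by do 6?[case: k => [|k] //]; move=> _; congr comb2; lia.
Qed.

Lemma dih_wordS c n : dih_word c n.+1 = rcons (dih_word c n) (letter (c (+) odd n)).
Proof. by rewrite /dih_word /rk2_alt mkseqS map_rcons. Qed.

Lemma dih_word_pos c k : (k < m)%N ->
  rpos (wmx (word_prod W (dih_word c k)) *m simple (letter (c (+) odd k))).
Proof.
move=> km; apply: rpos_of_poscone; first by rewrite wmx_root simple_root.
by rewrite dih_rootE //; apply: dih_root_pos.
Qed.

Lemma dih_word_reduced c k : (k <= m)%N -> reduced W (dih_word c k).
Proof.
elim: k => [_|k IH km]; first by rewrite /reduced word_nil wlen1.
by rewrite dih_wordS reduced_rconsE IH ?dih_word_pos // ltnW.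
Qed.

(** Both simple roots, hence all positive roots of rank two, are made negative by $w^{-1}$. So each
    letter stripped from the left of [w] lowers the length by one, whichever letter comes first. *)
Lemma dih_peel c k w : ~~ rpos (wmx w^-1%g *m simple i) ->
    ~~ rpos (wmx w^-1%g *m simple j) -> (k <= m)%N ->
  wlen w = (k + wlen ((word_prod W (dih_word c k))^-1 * w)%g)%N.
Proof.
move=> wi wj; elim: k => [_|k IH km]; first by rewrite word_nil invg1 mul1g.
rewrite (IH (ltnW km)) addSnnS; apply/eqP; rewrite eqn_add2l; apply/eqP.
rewrite -wlenV invMg invgK dih_wordS word_rcons.
rewrite (@wlen_sreflN _ _ _ (letter (c (+) odd k))).
  by rewrite -[in RHS]wlenV !invMg !invgK mulgA.
rewrite wmx_actM dih_rootE // /dih_root.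
set n := nth _ _ _; apply: rposN_poscone.
  rewrite wmx_root; have := dih_word_pos c km; rewrite dih_rootE //.
  exact: rpos_root.
have neg l : ~~ rpos (wmx w^-1%g *m simple l) -> poscone (- (wmx w^-1%g *m simple l)).
  by move=> wl; apply: rpos_poscone; rewrite rposNE ?wmx_root ?simple_root.
rewrite /comb2 -!natz !scaler_nat mulmxDr opprD.
by apply: posconeD; rewrite -scaler_nat -scalemxAr scaler_nat -mulNrn;
  apply/posconeMn/neg.
Qed.

End Dihedral.
End RankTwoWeyl.

(** * Braid relations for tau *)

Lemma foldr_mulr (R : pzRingType) (I : Type) (g : I -> R) (r : seq I) (x : R) :
  foldr (fun k => *%R (g k)) x r = \prod_(k <- r) g k * x.
Proof.
by elim: r => [|k r IH] /=; rewrite ?big_nil ?mul1r // big_cons IH mulrA.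
Qed.

Section Coefficients.
Variables (F : fieldType) (q t : F).
Hypotheses (t0 : t != 0) (t1 : 1 - t != 0).

Let t1' : t - 1 != 0. Proof. by rewrite -oppr_eq0 opprB. Qed.

Lemma dcoef_inv : (q - 1) / (1 - t^-1) = (q - 1) - (q - 1) / (1 - t).
Proof. by field; rewrite t1 t1' t0. Qed.

Lemma ccoef_plus : (q - t) / (1 - t^-1) * ((q - t^-1) / (1 - t)) =
  q + (q - 1) * ((q - 1) / (1 - t)) - ((q - 1) / (1 - t)) ^+ 2.
Proof. by field; rewrite t1 t1' t0. Qed.

Lemma ccoef_minus : (1 - q * t^-1) / (1 - t) * ((1 - q * t) / (1 - t^-1)) =
  q + (q - 1) * ((q - 1) / (1 - t)) - ((q - 1) / (1 - t)) ^+ 2.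
Proof. by field; rewrite t1 t1' t0. Qed.

Lemma ccoef_plus_neq0 : 1 - q * t^-1 != 0 -> (q - t) / (1 - t^-1) != 0.
Proof.
move=> qt; rewrite mulf_neq0 ?invr_eq0 //.
  by apply: contraNneq qt => /eqP; rewrite subr_eq0 => /eqP->; rewrite divff ?subrr.
by apply: contraNneq t1 => /eqP; rewrite !subr_eq0 => /eqP e; rewrite -[t]invrK -e invr1.
Qed.

Lemma ccoef_minus_neq0 : 1 - q * t^-1 != 0 -> (1 - q * t^-1) / (1 - t) != 0.
Proof. by move=> qt; rewrite mulf_neq0 ?invr_eq0. Qed.
End Coefficients.

Section LaurentField.
Variable m : nat.
Implicit Types (a : 'cV[int]_m).

(** Distinct Laurent monomials are linearly independent. This makes the denominators $1-e^a$ ($a\neq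
    0$) and $1-qe^a$ nonzero. *)
Lemma laurent_mono_neq1 n a : (n != 0) || (a != 0) -> 1 - qh ^ n * ex a != 0.
Proof.
move=> na; apply/eqP => e0.
pose g b : int * 'cV[int]_m := if b then (n, a) else (0, 0).
pose c (b : bool) : int := if b then -1 else 1.
have gI : {in [:: true; false] &, injective g}.
  have ga : (n, a) != (0, 0) by apply: contraTneq na => -[-> ->]; rewrite !eqxx.
  by move=> [] [] _ _ //= E; case/eqP: ga; first [exact: E|exact: esym E].
have := @laurent_free m _ [:: true; false] g c isT gI.
rewrite !big_cons big_nil /= expr0z ex0 !mulr1 addr0 mulN1r addrC.
by move=> /(_ e0 false); rewrite !inE => /(_ isT).
Qed.

Lemma one_sub_ex_neq0 a : a != 0 -> 1 - ex a != 0.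
Proof. by move=> a0; have := @laurent_mono_neq1 0 a; rewrite expr0z mul1r a0; apply. Qed.

Lemma one_sub_qp_ex_neq0 a : 1 - qp * ex a != 0.
Proof. exact: (@laurent_mono_neq1 2%:Z). Qed.

Lemma qp_neq0 : qp != 0 :> fracR m.
Proof. by rewrite expf_neq0 // qh_neq0. Qed.
End LaurentField.

Section TwistedTheory.
Variables (W : finGroupType) (F : fieldType) (A : field_action W F).
Implicit Types (x y z : twisted A) (u v w : W) (p : F).

Lemma tmul_scalel p x y : (p *: x) * y = p *: (x * y).
Proof. by rewrite tscaleAl. Qed.

Lemma tmul_coef x y u : (x * y) u = \sum_v x v * A v (y (v^-1 * u)%g).
Proof. exact: tmulE. Qed.

Lemma tdelta_mul_coef u y w : (tdelta A u * y) w = A u (y (u^-1 * w)%g).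
Proof.
rewrite tmul_coef (bigD1 u) //= big1 ?addr0 => [|v /negbTE nv].
  by rewrite tdeltaE eqxx mul1r.
by rewrite tdeltaE nv mul0r.
Qed.

Lemma tdelta_mul_scale u p y : tdelta A u * (p *: y) = A u p *: (tdelta A u * y).
Proof.
apply/ffunP => w; rewrite [RHS]ffunE !tdelta_mul_coef ffunE; exact: (rmorphM (A u)).
Qed.

Lemma tdeltaM u v : tdelta A u * tdelta A v = tdelta A (u * v)%g.
Proof.
apply/ffunP => w; rewrite tdelta_mul_coef !tdeltaE -(inj_eq (mulgI u)) mulKVg.
exact: (rmorph_nat (A u)).
Qed.

Lemma scale_tdeltaM p q u v :
  (p *: tdelta A u) * (q *: tdelta A v) = (p * A u q) *: tdelta A (u * v)%g.
Proof. by rewrite tmul_scalel tdelta_mul_scale tdeltaM scalerA. Qed.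

Lemma scale1D_mul p x y : (p *: (1 : twisted A) + x) * y = x * y + p *: y.
Proof. by rewrite mulrDl tmul_scalel mul1r addrC. Qed.

Lemma tdelta1 : tdelta A 1%g = 1.
Proof. by []. Qed.
End TwistedTheory.

Section Tau.
Variables (D : root_datum) (W : weyl_group D).
Implicit Types (u v w : W) (a b : 'cV[int]_(rk D)) (i j : 'I_(nsimple D)) (e : sgn).
Local Notation Roots := (Defs.roots D).
Local Notation s_ i := (srefl W i).
Local Notation delta := (tdelta (Qaction W)).
Local Notation Q := (Qfield D).

Definition Wmor w : {rmorphism Q -> Q} := fracR_rmorphism (@wmx_mul_inj D W w).

Lemma Wmor_ex w a : Wmor w (ex a) = ex (wmx w *m a).
Proof. exact: fracR_map_ex (@wmx_mul_inj D W w) a. Qed.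

Lemma Wmor_qp w : Wmor w qp = qp.
Proof. by rewrite rmorphXn /= (fracR_map_qh (@wmx_mul_inj D W w)). Qed.

Definition dfun a : Q := (qp - 1) / (1 - ex a).
Definition cfun e a : Q :=
  if e is Plus then (qp - ex a) / (1 - ex (- a)) else (1 - qp * ex (- a)) / (1 - ex a).

Lemma Wmor_dfun w a : Wmor w (dfun a) = dfun (wmx w *m a).
Proof. by rewrite fmorph_div !rmorphB rmorph1 Wmor_qp Wmor_ex. Qed.

Lemma Wmor_cfun w e a : Wmor w (cfun e a) = cfun e (wmx w *m a).
Proof.
rewrite /cfun; case: e;
  rewrite fmorph_div rmorphB [Wmor w (1 - _)]rmorphB rmorph1 ?Wmor_qp !Wmor_ex ?wmxN //.
by rewrite [Wmor w (qp * _)]rmorphM Wmor_qp Wmor_ex wmxN.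
Qed.

Lemma dfunN a : a != 0 -> dfun (- a) = (qp - 1) - dfun a.
Proof.
by move=> a0; rewrite /dfun exN; apply: dcoef_inv (ex_neq0 a) (one_sub_ex_neq0 a0).
Qed.

Lemma cfunN e a : a != 0 ->
  cfun e a * cfun e (- a) = qp + (qp - 1) * dfun a - dfun a ^+ 2.
Proof.
move=> a0; rewrite /cfun /dfun opprK !exN.
case: e; [apply: ccoef_plus|apply: ccoef_minus]; [exact: ex_neq0| |exact: ex_neq0|];
  exact: one_sub_ex_neq0.
Qed.

Lemma cfun_neq0 e a : a != 0 -> cfun e a != 0.
Proof.
move=> a0; have := one_sub_qp_ex_neq0 (- a); rewrite /cfun !exN.
case: e; [apply: ccoef_plus_neq0|apply: ccoef_minus_neq0];
  by [exact: ex_neq0|exact: one_sub_ex_neq0].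
Qed.

(* F_i, for the sign e. *)
Definition ftau e i : QW W := cfun e (simple i) *: delta (s_ i).

Lemma tauE e i : tau W e i = dfun (simple i) *: (1 : QW W) + ftau e i.
Proof. by case: e. Qed.

Lemma simple_neq0 i : simple i != 0 :> 'cV[int]_(rk D).
Proof. exact/root_neq0/simple_root. Qed.

Lemma delta_mul_scale u p (y : QW W) : delta u * (p *: y) = Wmor u p *: (delta u * y).
Proof. exact: tdelta_mul_scale. Qed.

Lemma scale_deltaM (p r : Q) u v :
  (p *: delta u) * (r *: delta v) = (p * Wmor u r) *: delta (u * v)%g.
Proof. exact: scale_tdeltaM. Qed.

Lemma ftau_scale e i (p : Q) (x : QW W) : ftau e i * (p *: x) = Wmor (s_ i) p *: (ftau e i * x).
Proof. by rewrite /ftau !tmul_scalel delta_mul_scale !scalerA mulrC. Qed.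

Lemma ftau2 e i : ftau e i * ftau e i =
  (qp + (qp - 1) * dfun (simple i) - dfun (simple i) ^+ 2) *: (1 : QW W).
Proof.
rewrite {2}/ftau ftau_scale tmul_scalel tdeltaM sreflK tdelta1 scalerA.
by rewrite Wmor_cfun srefl_simple mulrC cfunN ?simple_neq0.
Qed.

Definition Cprod e w : Q := \prod_(b <- Sigma_ w) cfun e b.

Lemma Cprod_srefl e w i : rpos (wmx w *m simple i) ->
  Cprod e (w * s_ i)%g = Cprod e w * cfun e (wmx w *m simple i).
Proof. by move=> wi; rewrite /Cprod (perm_big _ (Sigma_srefl wi)) big_cons mulrC. Qed.

Lemma Cprod_neq0 e w : Cprod e w != 0.
Proof.
rewrite /Cprod prodf_seq_neq0; apply/allP => b; rewrite mem_Sigma => /andP[bp _] /=.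
exact/cfun_neq0/root_neq0/rpos_root.
Qed.

(** Moving $\delta_w$ past the coefficient of $F_i$ evaluates it at $w\alpha_i$, the root that the
    letter [i] adds to [Sigma_ w]. *)
Lemma ftau_reduced e s : reduced W s ->
  \prod_(i <- s) ftau e i = Cprod e (word_prod W s) *: delta (word_prod W s).
Proof.
elim/last_ind: s => [|s i IH].
  by rewrite big_nil word_nil /Cprod Sigma1 big_nil scale1r.
rewrite reduced_rconsE => /andP[/IH E wi].
rewrite (word_rcons W s i).
rewrite (Cprod_srefl e wi).
rewrite -(Wmor_cfun (word_prod W s) e (simple i)).
rewrite -(scale_deltaM (Cprod e (word_prod W s)) (cfun e (simple i)) (word_prod W s) (s_ i)).
rewrite -E.
rewrite -cats1.
rewrite big_cat.
rewrite big_seq1.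
by [].
Qed.

Definition tau_seq e s : QW W := \prod_(i <- s) tau W e i.

(** The rank two recursion is run with left multiplication by $F_i$ and $F_j$ as the operators [f],
    starting from the vector 1. *)
Lemma tau_braid e i j X : i != j -> X \in rk2_type ->
    X.1 = (cartan i j, cartan j i) ->
  tau_seq e (dih_word i j true (size X.2)) = tau_seq e (dih_word i j false (size X.2)).
Proof.
move=> ij Xtype Xij; set m := size X.2.
pose L := letter i j; pose s c := Wmor (s_ (L c)); pose f c (x : QW W) := ftau e (L c) * x.
pose t := ex (simple i) : Q; pose u := ex (simple j) : Q.
pose d := rk2_d qp t u X.2.
have dE k : d k = dfun (dih_root i j X k).
  by rewrite /dfun /dih_root /comb2 exD !exZ.
have [m0 m4] : (0 < m)%N /\ m \in [:: 2; 3; 4; 6]%N.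
  move: Xtype; rewrite /m; clear; case: X => ab rs.
  by rewrite !inE => /or4P[]/eqP[_ ->].
have droot c : d (rk2_root m c) = dfun (simple (L c)).
  by rewrite dE; case: c; rewrite /= ?dih_root0 // dih_root_last.
have fD c x y : f c (x + y) = f c x + f c y by rewrite /f mulrDr.
have fZ c p x : f c (p *: x) = s c p *: f c x by exact: ftau_scale.
have f2 c x : f c (f c x) =
  (qp + (qp - 1) * d (rk2_root m c) - d (rk2_root m c) ^+ 2) *: x.
  by rewrite /f mulrA ftau2 tmul_scalel mul1r droot.
have sq c : s c qp = qp by exact: Wmor_qp.
have sp c : s c (qp - 1) = qp - 1 by rewrite rmorphB rmorph1 sq.
have rroot k : (k < m)%N -> dih_root i j X k != 0.
  move=> km; rewrite -(dih_rootE W ij Xtype Xij true km) /=.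
  by apply: root_neq0; rewrite wmx_root simple_root.
have sd c k : (k < m)%N -> s c (d k) = rk2_refl (qp - 1) m c d k.
  move=> km; rewrite dE Wmor_dfun /rk2_refl; case: c.
    case: k km => [|k] km.
      by rewrite dih_root0 // srefl_simple dfunN ?simple_neq0 // dE dih_root0.
    by rewrite dih_root_refll // dE.
  case: eqnP => [->|nk].
    by rewrite dih_root_last // srefl_simple dfunN ?simple_neq0 // dE dih_root_last.
  have k1 : (k.+1 < m)%N by move: m0 km nk; clear; move: m => n; lia.
  by rewrite dih_root_reflr // dE.
have fE c n : foldr f 1 (rk2_alt c n) = \prod_(k <- dih_word i j c n) ftau e k.
  by rewrite foldr_mulr mulr1 [RHS]big_map.
(* Both alternating words are reduced with the same product, on which $C_w\delta_w$ depends
   alone. *)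
have fbraid : foldr f 1 (rk2_alt true m) = foldr f 1 (rk2_alt false m).
  rewrite !fE !ftau_reduced; try exact: (dih_word_reduced _ _ Xtype).
  by rewrite (dih_braid W ij Xtype Xij).
have coefs k : (k < m.*2)%N -> rk2_word (qp - 1) qp m (rk2_alt true m) k d =
   rk2_word (qp - 1) qp m (rk2_alt false m) k d.
  move=> km; apply: rk2_coef => // r rX.
  have -> : t ^+ r.1 * u ^+ r.2 = ex (comb2 i j r.1 r.2) by rewrite /comb2 exD !exZ.
  apply: one_sub_ex_neq0.
  by have := rroot (index r X.2); rewrite /dih_root nth_index // index_mem; apply.
have := rk2_braid m0 fD fZ f2 sp sq sd m4 fbraid coefs.
have tE c n : foldr (rk2_tau m d f) 1 (rk2_alt c n) = tau_seq e (dih_word i j c n).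
  rewrite /tau_seq [RHS]big_map -[RHS]mulr1 -foldr_mulr.
  elim: (rk2_alt c n) => //= b r ->.
  by rewrite /rk2_tau /f droot tauE scale1D_mul.
by rewrite !tE.
Qed.

End Tau.

(** * Hecke relations for tau_w *)

Lemma scale_quadratic (F : fieldType) (V : lmodType F) (d p q : F) (x y : V) :
  (p - d) *: x + (q + p * d - d ^+ 2) *: y + d *: (d *: y + x) =
  p *: (d *: y + x) + q *: y.
Proof.
rewrite !scalerDr !scalerA [(d * d) *: y + _]addrC addrACA -!scalerDl.
by rewrite [RHS]addrAC -[X in _ = X + _]scalerDl [RHS]addrC; congr (_ *: _ + _ *: _); ring.
Qed.

Section TwistedScalars.
Variables (W : finGroupType) (F : fieldType) (A : field_action W F).
Implicit Types (x y z : twisted A) (u v w : W) (p : F).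

Lemma tmul_scale_fixed p x y : (forall u, A u p = p) -> x * (p *: y) = p *: (x * y).
Proof.
move=> fp; apply/ffunP => w; rewrite [RHS]ffunE !tmul_coef scaler_sumr.
apply: eq_bigr => v _; rewrite ffunE.
transitivity (x v * (A v p * A v (y (v^-1 * w)%g))).
  congr (_ * _); exact: (rmorphM (A v)).
rewrite fp; exact: mulrCA.
Qed.

(** In the square of [d + x], moving [d] to the left of [x] turns it into [p - d], so the two cross
    terms add up to [p *: x]. *)
Lemma tmul_quadratic (d p q : F) (f : F -> F) x :
    (forall c y, x * (c *: y) = f c *: (x * y)) ->
    x * x = (q + p * d - d ^+ 2) *: (1 : twisted A) -> f d = p - d ->
  let t := d *: (1 : twisted A) + x in t * t = p *: t + q *: (1 : twisted A).
Proof.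
move=> xs xx fd t; rewrite {1}/t scale1D_mul /t mulrDr xs xx fd mulr1.
exact: scale_quadratic.
Qed.

Lemma tmul_sum (I : Type) (r : seq I) (k : I -> F) (T : I -> twisted A) y :
  (\sum_(i <- r) k i *: T i) * y = \sum_(i <- r) k i *: (T i * y).
Proof. by rewrite mulr_suml; apply: eq_bigr => i _; rewrite tmul_scalel. Qed.

Lemma tmul_quad_step (p q : F) x (t : twisted A) : (forall u, A u p = p) -> (forall u, A u q = q) ->
  t * t = p *: t + q *: (1 : twisted A) -> x * t * t = p *: (x * t) + q *: x.
Proof. by move=> fp fq tt; rewrite -mulrA tt mulrDr !tmul_scale_fixed // mulr1. Qed.
End TwistedScalars.

Section Hecke.
Variables (D : root_datum) (W : weyl_group D).
Implicit Types (u v w : W) (i j : 'I_(nsimple D)) (e : sgn).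
Local Notation s_ i := (srefl W i).
Local Notation delta := (tdelta (Qaction W)).
Local Notation Q := (Qfield D).
Local Notation qp := (qp : Q).

Lemma dih_word_cons i j c n : dih_word i j c n.+1 = letter i j c :: dih_word i j (~~ c) n.
Proof.
rewrite /dih_word /rk2_alt /mkseq /= addbF; congr (_ :: map _ _).
rewrite (iotaDl 1 0) -map_comp; apply: eq_map => k /=.
by case: c; case: (odd k).
Qed.

Lemma tau_seq_cons e i s : tau_seq W e (i :: s) = tau W e i * tau_seq W e s.
Proof. exact: big_cons. Qed.

Lemma tau_seq_cat e s t : tau_seq W e (s ++ t) = tau_seq W e s * tau_seq W e t.
Proof. exact: big_cat. Qed.

Lemma tau_seq_rcons e s i : tau_seq W e (rcons s i) = tau_seq W e s * tau W e i.
Proof. by rewrite -cats1 tau_seq_cat; congr (_ * _); exact: big_seq1. Qed.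

Lemma wlen_cons_descent i r : reduced W (i :: r) ->
  ~~ rpos (wmx (word_prod W (i :: r))^-1%g *m simple i).
Proof.
move=> red; rewrite -wlen_lt_srefl -leqNgt.
have -> : ((word_prod W (i :: r))^-1 * s_ i = (word_prod W r)^-1)%g.
  by rewrite word_cons invMg sreflV -mulgA sreflK mulg1.
by rewrite !wlenV (eqP red) (leq_trans (wlen_word W r)).
Qed.

(* If two reduced words of w start with i <> j, then w also has reduced words
   starting with the two longest alternating words in i and j. *)
Lemma tau_seq_reduced e s s' : reduced W s -> reduced W s' ->
  word_prod W s = word_prod W s' -> tau_seq W e s = tau_seq W e s'.
Proof.
have [n] := ubnP (size s); elim: n s s' => // n IH s s'.
case: s => [|i r] szn red red' E.
  by move: red'; rewrite /reduced -E word_nil wlen1 eq_sym => /nilP->.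
case: s' => [|j r'] in red' E *.
  by move: red; rewrite /reduced E word_nil wlen1.
have redr : reduced W r by apply: (@reduced_catr _ _ [:: i]).
have redr' : reduced W r' by apply: (@reduced_catr _ _ [:: j]).
have szrr : size r = size r'.
  by move: (eqP red) (eqP red'); rewrite E => -> [].
have {}szn : (size r < n)%N by [].
have [ij|ij] := eqVneq i j.
  rewrite ij in E *; rewrite !tau_seq_cons; congr (_ * _); apply: IH => //.
  by move: E; rewrite !word_cons => /mulgI.
have {}IH x y : (size x < n)%N -> reduced W x -> reduced W y ->
   word_prod W x = word_prod W y -> tau_seq W e x = tau_seq W e y by exact: IH.
(* Stated for arbitrary letters, so that [i] and [j] can be exchanged when the Cartan pair occurs in
   [rk2_type] in the other order. *)
suff key i1 j1 r1 r1' X : i1 != j1 -> X \in rk2_type ->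
    X.1 = (cartan i1 j1, cartan j1 i1) -> reduced W (i1 :: r1) -> reduced W (j1 :: r1') ->
    word_prod W (i1 :: r1) = word_prod W (j1 :: r1') -> (size r1 < n)%N ->
    (size r1' < n)%N -> tau_seq W e (i1 :: r1) = tau_seq W e (j1 :: r1').
  have [X Xt [XE|XE]] := cartan_type W ij; first by apply: (key _ _ _ _ X) => //; rewrite -szrr.
  by apply/esym; apply: (key _ _ _ _ X); rewrite // ?[j == i]eq_sym // -szrr.
move=> {i j r r' red red' E redr redr' szrr szn ij}.
set i := i1; set j := j1; set r := r1; set r' := r1' => ij Xt XE red red' E sz sz'.
have [m mE] : exists m, size X.2 = m.+1.
  by move: Xt; clear; case: X => ab rs; rewrite !inE => /or4P[]/eqP[_ ->] /=; eexists.
set w := word_prod W (i :: r) in E.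
have wi : ~~ rpos (wmx w^-1%g *m simple i) by exact: wlen_cons_descent.
have wj : ~~ rpos (wmx w^-1%g *m simple j) by rewrite E; exact: wlen_cons_descent.
have [t [tE tz]] := wordP ((word_prod W (dih_word i j true m.+1))^-1 * w)%g.
have wE c : word_prod W (dih_word i j c m.+1 ++ t) = w.
  have bE := dih_braid W ij Xt XE; rewrite mE in bE.
  by case: c; rewrite word_cat ?tE -?bE ?tE mulKVg.
have redt c : reduced W (dih_word i j c m.+1 ++ t).
  rewrite /reduced wE size_cat tz size_map size_mkseq.
  by apply/eqP; apply: (dih_peel ij Xt XE true wi wj); rewrite mE.
(* Two reduced words of [w] with the same first letter: the induction hypothesis applies to their
   tails. *)
have half i2 r2 c : reduced W (i2 :: r2) -> word_prod W (i2 :: r2) = w -> (size r2 < n)%N ->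
    letter i j c = i2 -> tau_seq W e (i2 :: r2) = tau_seq W e (dih_word i j c m.+1 ++ t).
  move=> red2 w2 s2 i2E; have := redt c; have := wE c.
  rewrite dih_word_cons cat_cons i2E -{1}w2 !word_cons => /mulgI E2 red3.
  rewrite !tau_seq_cons; congr (_ * _); apply: IH => //.
    exact: (@reduced_catr _ _ [:: i2]).
  exact: (@reduced_catr _ _ [:: i2] _ red3).
rewrite (half i r true) // (half j r' false) // !tau_seq_cat; congr (_ * _).
by have := tau_braid W e ij Xt XE; rewrite mE.
Qed.

Lemma tauw_seq e s : reduced W s -> tauw e (word_prod W s) = tau_seq W e s.
Proof.
move=> red; apply: tau_seq_reduced => //; first exact: reduced_redword.
exact/eqP/(xchooseP (redword_exists _)).
Qed.

Lemma tauw_up e w i : rpos (wmx w *m simple i) ->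
  tauw e (w * s_ i)%g = tauw e w * tau W e i.
Proof.
have [s [<- z]] := wordP w => wi; have red : reduced W s by rewrite /reduced z.
by rewrite -word_rcons !tauw_seq ?reduced_rconsE ?red // tau_seq_rcons.
Qed.

Lemma tauw1 e : tauw e (1%g : W) = 1.
Proof.
have red : reduced W [::] by rewrite /reduced word_nil wlen1.
by rewrite -word_nil tauw_seq // /tau_seq big_nil.
Qed.

Lemma Qaction_qp u : Qaction W u qp = qp.
Proof. exact: Wmor_qp. Qed.

Lemma Qaction_qp1 u : Qaction W u (qp - 1) = qp - 1.
Proof. by rewrite -[LHS]/(Wmor u (qp - 1)) rmorphB rmorph1 Wmor_qp. Qed.

Lemma tau2 e i : tau W e i * tau W e i = (qp - 1) *: tau W e i + qp *: (1 : QW W).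
Proof.
rewrite tauE; apply: (tmul_quadratic (@ftau_scale D W e i)); first exact: ftau2.
by rewrite Wmor_dfun srefl_simple dfunN ?simple_neq0.
Qed.

Lemma tauw_tau e w i : tauw e w * tau W e i =
  if rpos (wmx w *m simple i) then tauw e (w * s_ i)%g
  else (qp - 1) *: tauw e w + qp *: tauw e (w * s_ i)%g.
Proof.
case: ifPn => wi; first by rewrite tauw_up.
have wsi : rpos (wmx (w * s_ i)%g *m simple i).
  by rewrite wmx_actM srefl_simple wmxN rposNE ?wmx_root ?simple_root.
have {1 2}-> : w = (w * s_ i * s_ i)%g by rewrite -mulgA sreflK mulg1.
rewrite (tauw_up e wsi).
exact: (tmul_quad_step _ Qaction_qp1 Qaction_qp (tau2 e i)).
Qed.

End Hecke.

(** * Expansion of delta_w *)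

Lemma mulVf_eq (F : fieldType) (c x y : F) : c != 0 -> c * x = y -> x = c^-1 * y.
Proof. by move=> c0 <-; rewrite mulKf. Qed.

Lemma tdelta_scale_srefl (W : finGroupType) (F : fieldType) (A : field_action W F)
    (d c p : F) (t : twisted A) u v :
    t = d *: (1 : twisted A) + c *: tdelta A v ->
  (p * A u c) *: tdelta A (u * v)%g =
  (p *: tdelta A u) * t - A u d *: (p *: tdelta A u).
Proof.
move=> ->; rewrite -[1 : twisted A]/(tdelta A 1%g) mulrDr !scale_tdeltaM mulg1.
by rewrite scalerA [A u d * p]mulrC addrAC subrr add0r.
Qed.

Lemma twisted_sum_single (W : finGroupType) (F : fieldType) (A : field_action W F)
    (T : W -> twisted A) (c : W -> F) w :
  (forall v, c v = (v == w)%:R) -> \sum_v c v *: T v = T w.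
Proof.
move=> cE; rewrite (bigD1 w) //= big1 => [|v /negbTE nv].
  by rewrite addr0 cE eqxx scale1r.
by rewrite cE nv scale0r.
Qed.

Section TwistedBasis.
Variables (W : finGroupType) (F : fieldType) (A : field_action W F).
Variable T : W -> twisted A.
Hypothesis T_span : forall w, exists k : W -> F, tdelta A w = \sum_v k v *: T v.
Let X := [tuple T (enum_val i) | i < #|W|].

Let X_nth (i : 'I_#|W|) : X`_i = T (enum_val i).
Proof. by rewrite -tnth_nth tnth_mktuple. Qed.

Let T_sum (k : W -> F) :
  \sum_v k v *: T v = \sum_(i < #|W|) k (enum_val i) *: X`_i.
Proof.
rewrite (reindex_onto (@enum_val _ W) enum_rank) /=; last by move=> v _; rewrite enum_rankK.
by apply: eq_big => [i|i _]; rewrite ?enum_valK ?eqxx ?X_nth.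
Qed.

Lemma dim_twisted : \dim {: twisted A} = #|W|.
Proof. by rewrite dimvf /dim /= muln1. Qed.

(** A spanning family of [#|W|] vectors in dimension [#|W|]. *)
Lemma twisted_basis : basis_of fullv X.
Proof.
rewrite basisEdim size_tuple dim_twisted leqnn andbT; apply/subvP => z _.
rewrite (twisted_sum_delta z); apply: memv_suml => w _; apply: memvZ.
have [k ->] := T_span w; apply: memv_suml => v _; apply/memvZ/memv_span.
by rewrite -(enum_rankK v) -X_nth mem_nth // size_tuple.
Qed.

Lemma twisted_coordE z : z = \sum_v coord X (enum_rank v) z *: T v.
Proof.
rewrite T_sum {1}(coord_basis twisted_basis (memvf z)).
by apply: eq_bigr => i _; rewrite enum_valK.
Qed.

Lemma twisted_coord_sum k v : coord X (enum_rank v) (\sum_u k u *: T u) = k v.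
Proof. by rewrite T_sum coord_sum_free ?(basis_free twisted_basis) // enum_rankK. Qed.

Lemma twisted_sum_inj k k' : \sum_u k u *: T u = \sum_u k' u *: T u -> k =1 k'.
Proof. by move=> E v; rewrite -(twisted_coord_sum k) E twisted_coord_sum. Qed.

Lemma twisted_coord_eq z k v : z = \sum_u k u *: T u -> coord X (enum_rank v) z = k v.
Proof. by move=> ->; rewrite twisted_coord_sum. Qed.

Lemma twisted_coord_scale (c : F) z k v : c *: z = \sum_u k u *: T u ->
  c * coord X (enum_rank v) z = k v.
Proof. by move=> E; rewrite -(twisted_coord_sum k) -E linearZ. Qed.

End TwistedBasis.

Section HeckeExpansion.
Variables (D : root_datum) (W : weyl_group D).
Implicit Types (u v w : W) (i j : 'I_(nsimple D)) (e : sgn).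
Local Notation s_ i := (srefl W i).
Local Notation delta := (tdelta (Qaction W)).
Local Notation Q := (Qfield D).

Lemma rpos_mul_srefl w i : rpos (wmx (w * s_ i)%g *m simple i) = ~~ rpos (wmx w *m simple i).
Proof. by rewrite wmx_actM srefl_simple wmxN rposNE ?wmx_root ?simple_root. Qed.

(** The coefficient of $\tau_v$ in $(\sum_u k_u\tau_u)\tau_i$. The field is arbitrary because the
    rule serves both in $Q_W$ and in $\hat Q_W$. *)
Definition hecke_mul (F : fieldType) (q : F) (k : W -> F) i v : F :=
  if rpos (wmx v *m simple i) then q * k (v * s_ i)%g
  else k (v * s_ i)%g + (q - 1) * k v.

Lemma hecke_mul_sum (F : fieldType) (A : field_action W F) (T Ti : W -> twisted A) (q : F) k i :
    (forall u, Ti u = if rpos (wmx u *m simple i) then T (u * s_ i)%g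
                      else (q - 1) *: T u + q *: T (u * s_ i)%g) ->
  \sum_u k u *: Ti u = \sum_v hecke_mul q k i v *: T v.
Proof.
move=> TiE.
transitivity (\sum_u ((if rpos (wmx u *m simple i) then 1 else q) * k u) *: T (u * s_ i)%g
     + \sum_u ((if rpos (wmx u *m simple i) then 0 else q - 1) * k u) *: T u).
  rewrite -big_split /=; apply: eq_bigr => u _; rewrite TiE.
  case: ifP => _; first by rewrite mul1r mul0r scale0r addr0.
  by rewrite scalerDr !scalerA addrC ![k u * _]mulrC.
rewrite (reindex_inj (mulIg (s_ i))) -big_split /=; apply: eq_bigr => v _.
rewrite -mulgA sreflK mulg1 rpos_mul_srefl /hecke_mul -scalerDl; congr (_ *: _).
by case: (rpos _); rewrite /= ?mul0r ?addr0 ?mul1r.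
Qed.

Lemma hecke_mul_step (F : fieldType) (A : field_action W F) (T : W -> twisted A)
    (x t : twisted A) (q c : F) (k : W -> F) i :
    x = \sum_u k u *: T u ->
    (forall u, T u * t = if rpos (wmx u *m simple i) then T (u * s_ i)%g
                         else (q - 1) *: T u + q *: T (u * s_ i)%g) ->
  x * t - c *: x = \sum_v (hecke_mul q k i v - c * k v) *: T v.
Proof.
move=> -> Tt; rewrite tmul_sum (hecke_mul_sum _ Tt) scaler_sumr -sumrB.
by apply: eq_bigr => v _; rewrite scalerA scalerBl.
Qed.

Lemma hecke_mul_bruhat (F : fieldType) (q : F) k i w :
    rpos (wmx w *m simple i) -> (forall v, ~~ bruhat v w -> k v = 0) ->
  forall v, ~~ bruhat v (w * s_ i)%g -> hecke_mul q k i v = 0.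
Proof.
move=> wi k0 v nv.
have kv : k v = 0 by apply: k0; apply: contra nv => vw; case: (bruhat_lift wi vw).
have kvs : k (v * s_ i)%g = 0.
  apply: k0; apply: contra nv => /(bruhat_lift wi)[_].
  by rewrite -mulgA sreflK mulg1.
by rewrite /hecke_mul kv kvs !mulr0 addr0; case: ifP.
Qed.

Definition K_step k w i v : Q := hecke_mul qp k i v - dfun (wmx w *m simple i) * k v.

Lemma delta_expansion_srefl e w i k : rpos (wmx w *m simple i) ->
    Cprod e w *: delta w = \sum_v k v *: tauw e v ->
  Cprod e (w * s_ i)%g *: delta (w * s_ i)%g = \sum_v K_step k w i v *: tauw e v.
Proof.
move=> wi kE; rewrite (Cprod_srefl e wi) -(Wmor_cfun w e (simple i)).
have step := hecke_mul_step (dfun (wmx w *m simple i)) kE (fun u => tauw_tau e u i).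
apply: etrans step; rewrite -Wmor_dfun.
apply: tdelta_scale_srefl; exact: tauE.
Qed.

(** The family [k] is chosen before the sign [e]: the recursion [K_step] involves only the
    $d(\beta)$, which are common to both signs. The lifting property keeps its support below [w]. *)
Lemma delta_expansion w : exists k : W -> Q, (forall v, ~~ bruhat v w -> k v = 0) /\
  forall e, Cprod e w *: delta w = \sum_v k v *: tauw e v.
Proof.
elim/wlen_ind: w => [|w i wi [k [k0 kE]]].
  exists (fun v => (v == 1%g)%:R); split.
    by move=> v; case: eqP => // ->; rewrite bruhat_refl.
  move=> e; rewrite (@twisted_sum_single _ _ _ _ _ 1%g) // tauw1.
  by rewrite /Cprod Sigma1 big_nil scale1r.
exists (K_step k w i); split=> [v nv|e]; last exact: delta_expansion_srefl.
rewrite /K_step (hecke_mul_bruhat _ wi k0 nv) k0 ?mulr0 ?subrr //.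
by apply: contra nv => vw; case: (bruhat_lift wi vw).
Qed.

Lemma tauw_span e w : exists k : W -> Q, delta w = \sum_v k v *: tauw e v.
Proof.
have [k [_ kE]] := delta_expansion w; exists (fun v => (Cprod e w)^-1 * k v).
under eq_bigr => v _ do rewrite -scalerA.
by rewrite -scaler_sumr -kE scalerA mulVf ?scale1r // Cprod_neq0.
Qed.

(* Up to the factor Cprod the coefficients of delta_w do not depend on the sign:
   they are the coefficients K of the root polynomials. *)
Definition Kb v w : Q := Cprod Minus w * bcoef Minus w v.

Lemma KbE w k : (forall e, Cprod e w *: delta w = \sum_v k v *: tauw e v) ->
  forall v, k v = Kb v w.
Proof.
move=> kE v; apply/esym; exact: (twisted_coord_scale (tauw_span Minus) v (kE Minus)).
Qed.

Lemma Kb_expansion e w : Cprod e w *: delta w = \sum_v Kb v w *: tauw e v.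
Proof.
have [k [_ kE]] := delta_expansion w; rewrite kE.
by apply: eq_bigr => v _; rewrite (KbE kE).
Qed.

Lemma Kb_bruhat v w : ~~ bruhat v w -> Kb v w = 0.
Proof. by have [k [k0 kE]] := delta_expansion w; rewrite -(KbE kE); apply: k0. Qed.

Lemma bcoefE e w v : bcoef e w v = (Cprod e w)^-1 * Kb v w.
Proof.
apply: (mulVf_eq (Cprod_neq0 e w)).
exact: (twisted_coord_scale (tauw_span e) v (Kb_expansion e w)).
Qed.

Lemma Kb_srefl w i v : rpos (wmx w *m simple i) ->
  Kb v (w * s_ i)%g = K_step (Kb^~ w) w i v.
Proof.
move=> wi; apply/esym/KbE => e; apply: delta_expansion_srefl => //.
exact: Kb_expansion.
Qed.

Lemma Kb1 v : Kb v 1%g = (v == 1%g)%:R.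
Proof.
apply/esym; apply: (@KbE 1%g (fun v => (v == 1%g)%:R)) => e.
rewrite (@twisted_sum_single _ _ _ _ _ 1%g) // tauw1.
by rewrite /Cprod Sigma1 big_nil scale1r.
Qed.
End HeckeExpansion.

(** * Root polynomials *)

Section TwistedMap.
Variables (W : finGroupType) (F F' : fieldType).
Variables (A : field_action W F) (A' : field_action W F') (f : {rmorphism F -> F'}).
Hypothesis fA : forall w x, f (A w x) = A' w (f x).

Definition tmap (z : twisted A) : twisted A' := [ffun w => f (z w)].

Lemma tmapM x y : tmap (x * y) = tmap x * tmap y.
Proof.
apply/ffunP => w; rewrite ffunE !tmul_coef rmorph_sum; apply: eq_bigr => v _.
by rewrite !ffunE rmorphM fA.
Qed.

Lemma tmapZ p x : tmap (p *: x) = f p *: tmap x.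
Proof. by apply/ffunP => w; rewrite !ffunE rmorphM. Qed.

Lemma tmapD x y : tmap (x + y) = tmap x + tmap y.
Proof. by apply/ffunP => w; rewrite !ffunE rmorphD. Qed.

Lemma tmap_linear p q p' q' x y : f p = p' -> f q = q' ->
  tmap (p *: x + q *: y) = p' *: tmap x + q' *: tmap y.
Proof. by move=> <- <-; rewrite tmapD !tmapZ. Qed.

Lemma tmap_delta w : tmap (tdelta A w) = tdelta A' w.
Proof. by apply/ffunP => v; rewrite !ffunE rmorph_nat. Qed.

Lemma tmap_sum (I : Type) (r : seq I) (k : I -> F) (T : I -> twisted A) :
  tmap (\sum_(i <- r) k i *: T i) = \sum_(i <- r) f (k i) *: tmap (T i).
Proof.
elim: r => [|i r IH]; last by rewrite !big_cons tmapD tmapZ IH.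
by rewrite !big_nil; apply/ffunP => w; rewrite !ffunE rmorph0.
Qed.
End TwistedMap.

Lemma twisted_sum_cond (W : finGroupType) (F : fieldType) (A : field_action W F)
    (T : W -> twisted A) (P : pred W) (c : W -> F) :
  (forall v, ~~ P v -> c v = 0) -> \sum_v c v *: T v = \sum_(v | P v) c v *: T v.
Proof.
move=> c0; rewrite [RHS]big_mkcond; apply: eq_bigr => v _.
by case: ifPn => // /c0->; rewrite scale0r.
Qed.

Lemma twisted_sum_inj_cond (W : finGroupType) (F : fieldType) (A : field_action W F)
    (T : W -> twisted A) (P : pred W) k k' :
    (forall w, exists k : W -> F, tdelta A w = \sum_v k v *: T v) ->
    \sum_(v | P v) k v *: T v = \sum_(v | P v) k' v *: T v ->
  forall v, P v -> k v = k' v.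
Proof.
move=> Tspan; have E l : \sum_(v | P v) l v *: T v = \sum_v (if P v then l v else 0) *: T v.
  by rewrite big_mkcond; apply: eq_bigr => v _; case: (P v); rewrite ?scale0r.
rewrite !E => /(twisted_sum_inj Tspan) H v Pv.
by have := H v; rewrite Pv.
Qed.

Lemma tmul_sub_fixed (W : finGroupType) (F : fieldType) (A : field_action W F)
    (x y : twisted A) c : (forall u, A u c = c) ->
  x * (y - c *: (1 : twisted A)) = x * y - c *: x.
Proof. by move=> fc; rewrite mulrBr tmul_scale_fixed // mulr1. Qed.

(** Each factor of a root polynomial depends only on its letter and the prefix before it, so a new
    last letter adds one factor and changes no other. *)
Lemma prod_take_rcons (R : pzRingType) (T : Type) (x0 : T) (g : seq T -> T -> R) s x :
  \prod_(j < size (rcons s x)) g (take j (rcons s x)) (nth x0 (rcons s x) j) =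
  (\prod_(j < size s) g (take j s) (nth x0 s j)) * g s x.
Proof.
rewrite size_rcons big_ord_recr /= nth_rcons ltnn eqxx.
rewrite -{3}cats1 take_size_cat //; congr (_ * _); apply: eq_bigr => j _.
by rewrite nth_rcons ltn_ord -cats1 takel_cat // ltnW.
Qed.

Section DoubleField.
Variables (D : root_datum) (W : weyl_group D).
Implicit Types (u v w : W) (i j : 'I_(nsimple D)) (e : sgn).
Local Notation s_ i := (srefl W i).
Local Notation Q := (Qfield D).
Local Notation R := (Qxy D).

Lemma inx_mul_inj :
  injective (mulmx (col_mx 1%:M 0) : 'cV[int]_(rk D) -> 'cV[int]_(rk D + rk D)).
Proof. by move=> a b; rewrite !mul_col_mx !mul1mx => /eq_col_mx[]. Qed.

Lemma iny_mul_inj :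
  injective (mulmx (col_mx 0 1%:M) : 'cV[int]_(rk D) -> 'cV[int]_(rk D + rk D)).
Proof. by move=> a b; rewrite !mul_col_mx !mul1mx => /eq_col_mx[]. Qed.

Let jx : 'M[int]_(rk D + rk D, rk D) := col_mx 1%:M 0.
Let jy : 'M[int]_(rk D + rk D, rk D) := col_mx 0 1%:M.

Definition inxr : {rmorphism Q -> R} := fracR_rmorphism inx_mul_inj.
Definition inyr : {rmorphism Q -> R} := fracR_rmorphism iny_mul_inj.

Lemma inxr_act w x : inxr (Qaction W w x) = Qxyaction W w (inxr x).
Proof.
transitivity (fracR_map (jx *m wmx w) x).
  exact/esym/(fracR_map_comp _ inx_mul_inj (@wmx_mul_inj D W w)).
transitivity (fracR_map (wmx2 w *m jx) x); last first.
  exact: (fracR_map_comp _ (@wmx2_mul_inj D W w) inx_mul_inj).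
congr fracR_map; rewrite /jx /wmx2 mul_col_mx mul_block_col.
by rewrite !(mul1mx, mul0mx, mulmx1, mulmx0, addr0).
Qed.

Lemma inyr_act w x : Qxyaction W w (inyr x) = inyr x.
Proof.
transitivity (fracR_map (wmx2 w *m jy) x).
  exact/esym/(fracR_map_comp _ (@wmx2_mul_inj D W w) iny_mul_inj).
congr fracR_map; rewrite /jy /wmx2 mul_block_col.
by rewrite !(mul0mx, mulmx1, mulmx0, add0r).
Qed.

Lemma inxr_qp : inxr qp = qp.
Proof. by rewrite rmorphXn /= (fracR_map_qh inx_mul_inj). Qed.

Lemma inxr_qp1 : inxr (qp - 1) = qp - 1.
Proof. by rewrite rmorphB rmorph1 inxr_qp. Qed.

Lemma inyr_qp : inyr qp = qp.
Proof. by rewrite rmorphXn /= (fracR_map_qh iny_mul_inj). Qed.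

Definition hatt (z : QW W) : hQW W := tmap (A := Qaction W) (Qxyaction W) inxr z.

Definition htau e v : hQW W := hatt (tauw e v).

Lemma htau_tau e u i : htau e u * hatt (tau W e i) =
  if rpos (wmx u *m simple i) then htau e (u * s_ i)%g
  else (qp - 1) *: htau e u + qp *: htau e (u * s_ i)%g.
Proof.
transitivity (hatt (tauw e u * tau W e i)).
  exact/esym/(tmapM inxr_act).
rewrite tauw_tau; case: ifP => _ //.
exact: (tmap_linear _ _ _ inxr_qp1 inxr_qp).
Qed.

Lemma htau_span e w : exists k : W -> R, tdelta (Qxyaction W) w = \sum_v k v *: htau e v.
Proof.
have [k kE] := tauw_span e w; exists (fun v => inxr (k v)).
transitivity (hatt (tdelta (Qaction W) w)); first exact/esym/tmap_delta.
by rewrite kE; apply: tmap_sum.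
Qed.

(** [hecke_mul] involves only [qp], which the embedding preserves, so the recursion over $Q$ becomes
    the recursion over $Q^y$. *)
Lemma inyr_K_step k w i v : inyr (K_step k w i v) =
  hecke_mul qp (fun u => inyr (k u)) i v - inyr (dfun (wmx w *m simple i)) * inyr (k v).
Proof.
rewrite /K_step /hecke_mul rmorphB rmorphM; congr (_ - _).
case: ifP => _; first by rewrite rmorphM inyr_qp.
by rewrite rmorphD rmorphM rmorphB rmorph1 inyr_qp.
Qed.

Lemma rootpoly_rcons e s i : rootpoly W e (in_tuple (rcons s i)) =
  rootpoly W e (in_tuple s) *
  (hatt (tau W e i) - inyr (dfun (wmx (word_prod W s) *m simple i)) *: (1 : hQW W)).
Proof.
pose g (r : seq 'I_(nsimple D)) k : hQW W := hatt (tau W e k) -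
  inyr (dfun (wmx (word_prod W r) *m simple k)) *: (1 : hQW W).
have gE r : rootpoly W e (in_tuple r) = \prod_(j < size r) g (take j r) (nth i r j).
  by apply: eq_bigr => j _; rewrite /beta (tnth_nth i).
rewrite !gE; exact: (prod_take_rcons i g).
Qed.

Lemma rootpoly_expansion e s : reduced W s ->
  rootpoly W e (in_tuple s) = \sum_v inyr (Kb v (word_prod W s)) *: htau e v.
Proof.
elim/last_ind: s => [_|s i IH].
  rewrite /rootpoly big_ord0 word_nil (@twisted_sum_single _ _ _ _ _ 1%g).
    by rewrite /htau tauw1; apply/esym/tmap_delta.
  by move=> v; rewrite Kb1 rmorph_nat.
rewrite reduced_rconsE => /andP[/IH{}IH wi]; rewrite rootpoly_rcons.
set c := inyr (dfun _); set X := rootpoly W e (in_tuple s) in IH *.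
have -> : X * (hatt (tau W e i) - c *: (1 : hQW W)) = X * hatt (tau W e i) - c *: X.
  apply: tmul_sub_fixed => u; exact: inyr_act.
rewrite (hecke_mul_step c IH (fun u => htau_tau e u i)).
apply: eq_bigr => v _; congr (_ *: _); rewrite word_rcons Kb_srefl //.
by rewrite inyr_K_step.
Qed.

Lemma Kb_is_Kcoef : is_Kcoef (@Kb D W).
Proof.
move=> e w s sw; have red : reduced W s by rewrite /reduced sw size_tuple.
have E : rootpoly W e s = rootpoly W e (in_tuple s).
  (* The length index [wlen w] of the tuple type is replaced by the size of the underlying
     sequence. *)
  case: s sw red => s sz _ _; have El := eqP sz; move: sz; rewrite -El => sz.
  by congr rootpoly; apply: val_inj.
apply: etrans E (etrans (rootpoly_expansion e red) _); rewrite sw.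
apply: (@twisted_sum_cond _ _ _ _ (fun v => bruhat v w)) => v /Kb_bruhat ->.
exact: rmorph0.
Qed.

(** [Kb] shows that [is_Kcoef] has a solution, so the chosen [Kcoef] is one. Two solutions agree
    below [w] because the images of the $\tau_v$ are independent over the larger field and [inyr] is
    injective. *)
Lemma KcoefE v w : bruhat v w -> Kcoef v w = Kb v w.
Proof.
move=> vw; have KP : is_Kcoef (@Kcoef D W).
  by apply: epsilon_spec; exists (@Kb D W); apply: Kb_is_Kcoef.
have sw := eqP (xchooseP (redword_exists w)).
have E := etrans (esym (KP Minus w (redword w) sw)) (Kb_is_Kcoef Minus sw).
have H := @twisted_sum_inj_cond _ _ _ _ (fun v => bruhat v w) (fun v => inyr (Kcoef v w))
  (fun v => inyr (Kb v w)) (htau_span Minus) E v vw.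
exact: (fmorph_inj inyr).
Qed.

End DoubleField.

(** * Dual module *)

Section TwistedDual.
Variables (W : finGroupType) (F : fieldType) (A : field_action W F).
Implicit Types (x y z t : twisted A) (u v w : W) (p q : F).
Local Notation dual := 'Hom(twisted A, F^o).

Definition tcoef w : dual := linfun (fun z : twisted A => z w : F^o).

Lemma tcoefE w z : tcoef w z = z w.
Proof.
have lin : linear (fun z : twisted A => z w : F^o).
  by move=> p x y; rewrite ffunE ffunE.
pose f : {linear twisted A -> F^o} :=
  HB.pack (fun z : twisted A => z w : F^o) (GRing.isLinear.Build _ _ _ _ _ lin).
by rewrite /tcoef (lfunE f).
Qed.

Lemma tdual_eq_span (T : W -> twisted A) (f g : dual) :
    (forall w, exists k : W -> F, tdelta A w = \sum_v k v *: T v) ->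
  (forall v, f (T v) = g (T v)) -> f = g.
Proof.
move=> Tspan fg; apply/lfunP => z; rewrite (twisted_coordE Tspan z) !linear_sum.
by apply: eq_bigr => v _; rewrite !linearZ /= fg.
Qed.

Lemma tdelta_span w : exists k : W -> F, tdelta A w = \sum_v k v *: tdelta A v.
Proof.
by exists (fun v => (v == w)%:R); rewrite (@twisted_sum_single _ _ _ _ _ w).
Qed.

Lemma tdual_eq (f g : dual) : (forall w, f (tdelta A w) = g (tdelta A w)) -> f = g.
Proof. exact: (tdual_eq_span tdelta_span). Qed.

Lemma tcoef_sum (P : pred W) (c : W -> F) u :
  (\sum_(v | P v) c v *: tcoef v) (tdelta A u) = if P u then c u else 0.
Proof.
rewrite sum_lfunE; under eq_bigr => v _ do rewrite scale_lfunE tcoefE tdeltaE.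
case: ifP => Pu; last first.
  rewrite big1 // => v Pv; have /negbTE-> : v != u by apply: contraFneq Pu => <-.
  exact: mulr0.
rewrite (bigD1 u) //= eqxx big1 ?addr0; first exact: mulr1.
by move=> v /andP[_ /negbTE->]; exact: mulr0.
Qed.

(** Over $Q$ this is convertible to [bullet], as [tcoef] is to [fd]; results proved for an arbitrary
    twisted algebra then apply directly. *)
Definition tbullet z (g : dual) : dual :=
  \sum_w \sum_v (\sum_v' g (tdelta A v') *: tcoef (v' * w^-1)%g) (tdelta A v) *:
    (A v (z w) *: tcoef v).

Lemma tbulletE z g : tbullet z g = (g \o trmul z)%VF.
Proof.
apply: tdual_eq => u; rewrite comp_lfunE trmulE sum_lfunE.
have -> : tdelta A u * z = \sum_w A u (z w) *: tdelta A (u * w)%g.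
  rewrite {1}(twisted_sum_delta z) mulr_sumr; apply: eq_bigr => w _.
  by rewrite tdelta_mul_scale tdeltaM.
rewrite linear_sum; apply: eq_bigr => w _; rewrite linearZ.
under eq_bigr => v _ do rewrite scalerA.
rewrite (tcoef_sum predT) mulrC; congr (_ * _).
rewrite (reindex_inj (mulIg w)) /=.
under eq_bigr => v _ do rewrite mulgK.
exact: (tcoef_sum predT).
Qed.

Lemma tmul_srefl_coef x (d c : F) s v :
  (x * (d *: (1 : twisted A) + c *: tdelta A s)) v =
  x v * A v d + x (v * s^-1)%g * A (v * s^-1)%g c.
Proof.
rewrite -[1 : twisted A]/(tdelta A 1%g) mulrDr ffunE !tmul_coef; congr (_ + _).
  rewrite (bigD1 v) //= big1 ?addr0 => [|u nu].
    by rewrite mulVg ffunE tdeltaE eqxx [d *: _]mulr1.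
  rewrite ffunE tdeltaE; have /negbTE-> : (u^-1 * v)%g != 1%g.
    by apply: contraNneq nu => e; rewrite -(mulKVg u v) e mulg1.
  by rewrite [d *: _]mulr0 rmorph0 mulr0.
rewrite (bigD1 (v * s^-1)%g) //= big1 ?addr0 => [|u nu].
  by rewrite invMg invgK -mulgA mulVg mulg1 ffunE tdeltaE eqxx [c *: _]mulr1.
rewrite ffunE tdeltaE; have /negbTE-> : (u^-1 * v)%g != s.
  by apply: contraNneq nu => <-; rewrite invMg invgK mulKVg.
by rewrite [c *: _]mulr0 rmorph0 mulr0.
Qed.

Lemma quad_unit q t : q != 0 -> (forall u, A u q = q) -> (forall u, A u (q - 1) = q - 1) ->
  t * t = (q - 1) *: t + q *: (1 : twisted A) -> t \is a GRing.unit.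
Proof.
move=> q0 fq fq1 tt; have fqV u : A u q^-1 = q^-1.
  by rewrite -{2}(fq u); exact: (fmorphV (A u)).
have fN u : A u (- (q - 1)) = - (q - 1).
  by rewrite -{2}(fq1 u); exact: (rmorphN (A u)).
apply/unitrP; exists (q^-1 *: (t - (q - 1) *: (1 : twisted A))).
have tE : t * t - (q - 1) *: t = q *: (1 : twisted A) by rewrite tt addrC addKr.
split.
  by rewrite tmul_scalel mulrBl tmul_scalel mul1r tE scalerA mulVf ?scale1r.
by rewrite tmul_scale_fixed // tmul_sub_fixed // tE scalerA mulVf ?scale1r.
Qed.

(** The quadratic relation gives $q\,t^{-1}=t-(q-1)$, which removes the inverse; [q] is fixed by the
    action and passes through [x]. *)
Lemma quad_inv_coef q t x y w : q != 0 ->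
    (forall u, A u q = q) -> (forall u, A u (q - 1) = q - 1) ->
    t * t = (q - 1) *: t + q *: (1 : twisted A) ->
  q * (x * t^-1 * y) w = (x * t * y) w - (q - 1) * (x * y) w.
Proof.
move=> q0 fq fq1 tt; have ut := quad_unit q0 fq fq1 tt.
have xE : q *: (x * t^-1) = x * t - (q - 1) *: x.
  apply: (mulIr ut); rewrite tmul_scalel mulrVK // mulrBl -mulrA tt.
  by rewrite mulrDr !tmul_scale_fixed // mulr1 tmul_scalel addrC addKr.
have -> : q * (x * t^-1 * y) w = ((q *: (x * t^-1)) * y) w by rewrite tmul_scalel ffunE.
by rewrite xE mulrBl tmul_scalel !ffunE.
Qed.
End TwistedDual.

(** * Stable bases *)

Lemma unitr_prod_seq (R : unitRingType) (I : Type) (g : I -> R) (r : seq I) :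
  (forall i, g i \is a GRing.unit) -> \prod_(i <- r) g i \is a GRing.unit.
Proof. by move=> ug; apply: rpred_prod. Qed.

Lemma mulr_invM (R : unitRingType) (x y t : R) : y \is a GRing.unit ->
  t \is a GRing.unit -> x * (y * t)^-1 = x * t^-1 * y^-1.
Proof. by move=> uy ut; rewrite invrM // mulrA. Qed.

Lemma tmul_linear2_coef (W : finGroupType) (F : fieldType) (A : field_action W F)
    (p q : F) (x y z : twisted A) w :
  ((p *: x + q *: y) * z) w = p * (x * z) w + q * (y * z) w.
Proof. by rewrite mulrDl !tmul_scalel !ffunE. Qed.

Lemma quad_step_up (F : fieldType) (c q X Y Z : F) :
  q * X = Y - (q - 1) * Z -> c * Z = 0 -> c * q * X = c * Y.
Proof. by move=> E cZ; rewrite -mulrA E mulrBr mulrCA cZ mulr0 subr0. Qed.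

Lemma quad_step_down (F : fieldType) (c q X Y Z V : F) :
  q * X = Y - (q - 1) * Z -> Y = (q - 1) * Z + q * V -> c * V = 0 -> c * q * X = 0.
Proof. by move=> + YE cV; rewrite YE addrC addKr -mulrA => ->; rewrite mulrCA cV mulr0. Qed.

Lemma tbullet_coef (W : finGroupType) (F : fieldType) (A : field_action W F)
    (z y : twisted A) (p : F) w :
  tbullet z (p *: tcoef A w) y = p * (y * z) w.
Proof. by rewrite tbulletE comp_lfunE trmulE scale_lfunE tcoefE. Qed.

Lemma tbullet_tdelta_coef (W : finGroupType) (F : fieldType) (A : field_action W F)
    (z : twisted A) (p : F) u :
  tbullet z (p *: tcoef A 1%g) (tdelta A u) = p * A u (z u^-1%g).
Proof. by rewrite tbullet_coef tdelta_mul_coef mulg1. Qed.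

Lemma linfun_coordE (F : fieldType) (V : vectType F) n (X : n.-tuple V) i z :
  linfun (fun z : V => coord X i z : F^o) z = coord X i z.
Proof.
have lin : linear (fun z : V => coord X i z : F^o) by move=> p x y; rewrite linearP.
pose f : {linear V -> F^o} :=
  HB.pack (fun z : V => coord X i z : F^o) (GRing.isLinear.Build _ _ _ _ _ lin).
by rewrite (lfunE f).
Qed.

Lemma mulr_eq0r (R : pzRingType) (x y : R) : y = 0 -> x * y = 0.
Proof. by move=> ->; rewrite mulr0. Qed.

Lemma mul_invf_div (F : fieldType) (x h m k : F) : x * ((h / m)^-1 * k) = x * m / h * k.
Proof. by rewrite invf_div !mulrA. Qed.

Lemma mulr_if_scale (F : fieldType) (p c h : F) (b : bool) : p * c = h ->
  p * (if b then c else 0) = h *: ((if b then 1 else 0) : F^o).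
Proof. by move=> <-; case: b; rewrite ?mulr0 ?scaler0 // [RHS]mulr1. Qed.

Lemma mulr_div_cancel (F : fieldType) (x h : F) : x != 0 -> x * (h / x) = h.
Proof. by move=> x0; rewrite mulrC divfK. Qed.

Lemma mulr_div_mid (F : fieldType) (h y x : F) : h != 0 -> h * y * x / h = y * x.
Proof. by move=> h0; rewrite -[h * y * x]mulrA mulrC mulKf. Qed.

Section Stable.
Variables (D : root_datum) (W : weyl_group D).
Implicit Types (u v w : W) (i j : 'I_(nsimple D)) (e : sgn).
Local Notation s_ i := (srefl W i).
Local Notation Q := (Qfield D).
Local Notation delta := (tdelta (Qaction W)).
Local Notation w0 := (w0 W).

Lemma bruhat_wlen u v : bruhat u v -> u = v \/ (wlen u < wlen v)%N.
Proof.
move=> /connectP[p]; elim: p u => [|x p IH] u /=; first by move=> _ ->; left.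
move=> /andP[/andP[ux _] pth] vE; right.
by case: (IH x pth vE) => [<- //|]; apply: ltn_trans.
Qed.

Lemma tauw_coef_bruhat e w v : ~~ bruhat v w -> tauw e w v = 0.
Proof.
elim/wlen_ind: w v => [|w i wi IH] v nv.
  by rewrite tauw1 tdeltaE; case: eqP nv => // ->; rewrite bruhat_refl.
rewrite (tauw_up e wi) tauE /ftau tmul_srefl_coef sreflV !IH ?mul0r ?addr0 //.
  by apply: contra nv => /(bruhat_lift wi)[_]; rewrite -mulgA sreflK mulg1.
by apply: contra nv => /(bruhat_lift wi)[].
Qed.

Lemma tauw_coef_diag e w : tauw e w w = Cprod e w.
Proof.
elim/wlen_ind: w => [|w i wi IH].
  by rewrite tauw1 tdeltaE eqxx /Cprod Sigma1 big_nil.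
rewrite (tauw_up e wi) tauE /ftau tmul_srefl_coef sreflV -mulgA sreflK mulg1 IH.
rewrite tauw_coef_bruhat ?mul0r ?add0r; last first.
  apply/negP => /bruhat_wlen; rewrite wlen_srefl // => -[E|]; last by lia.
  by have := wlen_srefl wi; rewrite E; lia.
by rewrite (Cprod_srefl e wi) -(Wmor_cfun w).
Qed.

(** Every other [v] is not above [w0], so evaluation at [w0] reads off the coefficient on
    $\tau_{w_0}$ up to the factor [Cprod e w0]. *)
Lemma tauw_coef_w0 e v : tauw e v w0 = if v == w0 then Cprod e w0 else 0.
Proof.
case: eqP => [->|nv]; first exact: tauw_coef_diag.
apply: tauw_coef_bruhat; apply/negP => /bruhat_wlen[/esym//|].
by rewrite ltnNge wlen_w0.
Qed.

(** Passing from [u] to [u s_i] replaces $\tau_v$ by $q\tau_v\tau_i^{-1}=\tau_v\tau_i-(q-1)\tau_v$.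
    If [v s_i] is longer, the correction vanishes, since [w0 u] has the descent [i] and so differs
    from [v]. If it is shorter, the terms in $\tau_v$ cancel and $q\tau_{vs_i}$ contributes zero, as
    [v s_i] lacks that descent. *)
Lemma tauw_inv_coef e u v :
  qw u * (tauw e v * (tauw e u)^-1) w0 = if v == (w0 * u)%g then Cprod e w0 else 0.
Proof.
have ut i : tau W e i \is a GRing.unit.
  exact: (quad_unit (@qp_neq0 (rk D)) (@Qaction_qp D W) (@Qaction_qp1 D W) (tau2 W e i)).
elim/wlen_ind: u v => [|u i ui IH] v.
  by rewrite tauw1 invr1 mulr1 mulg1 /qw wlen1 expr0 mul1r tauw_coef_w0.
have uu : tauw e u \is a GRing.unit.
  exact: unitr_prod_seq ut.
have -> : tauw e v * (tauw e (u * s_ i)%g)^-1 = tauw e v * (tau W e i)^-1 * (tauw e u)^-1.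
  rewrite (tauw_up e ui); exact: (mulr_invM (tauw e v) uu (ut i)).
have -> : qw (u * s_ i)%g = qw u * qp :> Q by rewrite /qw wlen_srefl // exprSr.
set X := fun_of_fin _ w0.
have step y : tauw e v * tau W e i = y ->
    qp * X = (y * (tauw e u)^-1) w0 - (qp - 1) * (tauw e v * (tauw e u)^-1) w0.
  move=> <-; exact: (quad_inv_coef (tauw e v) (tauw e u)^-1 w0 (@qp_neq0 (rk D))
    (@Qaction_qp D W) (@Qaction_qp1 D W) (tau2 W e i)).
have vs : rpos (wmx (v * s_ i)%g *m simple i) = ~~ rpos (wmx v *m simple i).
  exact: rpos_mul_srefl.
have w0u : rpos (wmx (w0 * u)%g *m simple i) = false.
  by rewrite wmx_actM rpos_w0 ?wmx_root ?simple_root // ui.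
have <- : ((v * s_ i)%g == (w0 * u)%g) = (v == (w0 * (u * s_ i))%g).
  by rewrite -(inj_eq (mulIg (s_ i))) -mulgA sreflK mulg1 mulgA.
case: (boolP (rpos (wmx v *m simple i))) => vi.
  have Tv : tauw e v * tau W e i = tauw e (v * s_ i)%g by rewrite tauw_tau vi.
  have IH0 : qw u * (tauw e v * (tauw e u)^-1) w0 = 0.
    apply: etrans (IH v) _; case: eqP => // vE.
    by move: vi; rewrite vE w0u.
  exact: etrans (quad_step_up (step _ Tv) IH0) (IH _).
have Tv := tauw_tau e v i; rewrite (negbTE vi) in Tv.
have nvs : ((v * s_ i)%g == (w0 * u)%g) = false.
  by apply/eqP => vE; move: vs; rewrite vE w0u vi.
have IH0 : qw u * (tauw e (v * s_ i)%g * (tauw e u)^-1) w0 = 0.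
  by apply: etrans (IH _) _; rewrite nvs.
rewrite nvs; apply: (quad_step_down (step _ Tv) _ IH0).
exact: tmul_linear2_coef.
Qed.

(** * The identities for the stable bases *)

Lemma QWdual_eq (f g : QWdual W) : (forall w, f (delta w) = g (delta w)) -> f = g.
Proof. exact: tdual_eq. Qed.

Lemma fd_sum (P : pred W) (c : W -> Q) u :
  (\sum_(v | P v) c v *: fd v) (delta u) = if P u then c u else 0.
Proof. exact: tcoef_sum. Qed.

Lemma St_plusE w : St_plus w = \sum_(v | bruhat v w)
  (Wact v (acoef Plus w^-1 v^-1) * xminus w0) *: fd v.
Proof.
apply: QWdual_eq => u; rewrite fd_sum.
apply: etrans (tbullet_tdelta_coef (tauw Plus w^-1) (xminus w0) u) _.
rewrite mulrC; case: ifPn => // nu; rewrite tauw_coef_bruhat ?bruhatV //.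
by rewrite -[Qaction W u 0]/(Wmor u 0) rmorph0 mul0r.
Qed.

Lemma taudualE e w (z : QW W) : taudual e w z = coord (taubasis W e) (enum_rank w) z.
Proof. exact: linfun_coordE. Qed.

Lemma taudual_tauw e w v : taudual e w (tauw e v) = if v == w then 1 else 0.
Proof.
have E : tauw e v = \sum_u (u == v)%:R *: tauw e u.
  by rewrite (@twisted_sum_single _ _ _ _ _ v).
rewrite taudualE; apply: etrans (twisted_coord_eq (tauw_span e) w E) _.
by rewrite eq_sym; case: eqP.
Qed.

Lemma taudual_sum w : xhatw w0 *: taudual Minus w =
  \sum_(v | bruhat w v) (xhatw w0 * bcoef Minus v w) *: fd v.
Proof.
apply: QWdual_eq => u; rewrite fd_sum scale_lfunE taudualE.
case: ifPn => // nu; apply: (@mulr_eq0r _ _ (bcoef Minus u w)).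
by rewrite bcoefE Kb_bruhat // mulr0.
Qed.

Lemma CprodE w : Cprod Minus w = xhatw w / xminus w.
Proof.
rewrite /xminus -prodfV -big_split; apply: eq_bigr => b _.
by rewrite /xr opprK.
Qed.

Lemma taudual_sum_K w :
  \sum_(v | bruhat w v) (xhatw w0 * bcoef Minus v w) *: fd v =
  \sum_(v | bruhat w v) (xhatw w0 * xminus v / xhatw v * Kcoef w v) *: fd v.
Proof.
apply: eq_bigr => v wv; congr (_ *: _); rewrite bcoefE CprodE KcoefE //.
exact: mul_invf_div.
Qed.

Lemma xhatw_neq0 w : xhatw w != 0.
Proof.
rewrite /xhatw prodf_seq_neq0; apply/allP => b _; exact: one_sub_qp_ex_neq0.
Qed.

Lemma xminus_neq0 w : xminus w != 0.
Proof.
rewrite /xminus prodf_seq_neq0; apply/allP => b; rewrite mem_Sigma => /andP[bp _].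
by apply: one_sub_ex_neq0; rewrite opprK; apply/root_neq0/rpos_root.
Qed.

Lemma xhatw_w0 v : xhatw w0 = xhatw v * Wact v (xhatw (v^-1 * w0)%g).
Proof.
rewrite {1}/xhatw (perm_big _ (Sigma_w0_split v)) big_cat big_map; congr (_ * _).
rewrite -[RHS]/(Wmor v _) rmorph_prod; apply: eq_bigr => b _.
by rewrite /xhat rmorphB rmorph1 [Wmor v (qp * _)]rmorphM Wmor_qp Wmor_ex wmxN.
Qed.

(** Both sides are compared on the basis $\tau^-_v$, using [tauw_inv_coef] at [u = w0 w], for which
    [w0 u = w]. *)
Lemma St_minusE w : qw (w0 * w)%g *: St_minus w = xhatw w0 *: taudual Minus w.
Proof.
apply: (tdual_eq_span (tauw_span Minus)) => v; rewrite !scale_lfunE taudual_tauw.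
apply: etrans (congr1 (fun c => qw (w0 * w)%g * c)
  (tbullet_coef (tauw Minus (w0 * w)%g)^-1 (tauw Minus v) (xminus w0) w0)) _.
rewrite mulrCA tauw_inv_coef mulgA w0K mul1g; apply: mulr_if_scale.
by rewrite CprodE; apply: mulr_div_cancel; apply: xminus_neq0.
Qed.

Lemma xhatw_w0_div v :
  xhatw w0 * xminus v / xhatw v = Wact v (xhatw (v^-1 * w0)%g) * xminus v.
Proof. by rewrite (xhatw_w0 v); apply: mulr_div_mid; apply: xhatw_neq0. Qed.

End Stable.
Theorem theorem7p5 (D : root_datum) (W : weyl_group D) (w : W) :
  St_plus w =
    \sum_(v | bruhat v w)
      (Wact v (acoef Plus w^-1 v^-1) * xminus (w0 W)) *: fd v
  /\
  [/\ qw (w0 W * w)%g *: St_minus w = xhatw (w0 W) *: taudual Minus w,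
      xhatw (w0 W) *: taudual Minus w =
        \sum_(v | bruhat w v) (xhatw (w0 W) * bcoef Minus v w) *: fd v,
      \sum_(v | bruhat w v) (xhatw (w0 W) * bcoef Minus v w) *: fd v =
        \sum_(v | bruhat w v)
          (xhatw (w0 W) * xminus v / xhatw v * Kcoef w v) *: fd v
    & \sum_(v | bruhat w v)
          (xhatw (w0 W) * xminus v / xhatw v * Kcoef w v) *: fd v =
        \sum_(v | bruhat w v)
          (Wact v (xhatw (v^-1 * w0 W)%g) * xminus v * Kcoef w v) *: fd v].
Proof.
split; first exact: St_plusE.
split; [exact: St_minusE|exact: taudual_sum|exact: taudual_sum_K|].
by apply: eq_bigr => v _; rewrite xhatw_w0_div.
Qed.
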